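(* Let $G=(V,E)$ be a finite simple bipartite graph with maximum degree $\Delta$, let $k\ge\Delta$, and let $C_1$ and $C_2$ be two edge $k$-colorings of $G$. Then $C_1$ can be transformed into $C_2$ in at most $6|E|$ steps in the Markov chain $M(G,k)$ (that is, via a sequence of at most $6|E|$ transitions of $M(G,k)$, each having positive probability).
   Context: **Colorings.** An edge $k$-coloring of $G=(V,E)$ is a map $C:E\to\{c_1,\dots,c_k\}$ such that no two adjacent edges have the same color. For a map $C:E\to\{c_1,\dots,c_k\}$, a vertex $v$ has a $(+c-c')$-deficiency (and is called deficient) if exactly two $c$-colored edges are incident to $v$, all other edges incident to $v$ have different colors, and no $c'$-colored edge is incident to $v$. An almost edge $k$-coloring is a map $C:E\to\{c_1,\dots,c_k\}$ such that at most two vertices have deficiency and all other vertices have no two incident edges of the same color. Flipping the colors along an alternating path, walk or cycle with colors $a,b$ means interchanging $a$ and $b$ on its edges. Eliminating a $(+a-b)$-deficiency at a vertex $v$ means: select uniformly one of the two $a$-edges at $v$ and flip the colors along the appropriate maximal alternating path (walk) with colors $a,b$ starting at $v$ with the selected edge. **The Markov chain $M(G,k)$.** $G$ is bipartite and $k\ge\Delta$. The states are the edge $k$-colorings of $G$. From the current coloring $C$, a random edge $k$-coloring is drawn as follows. (1) With probability $\frac12$, do nothing. (2) With probability $\frac14$, select two colors $c,c'$ uniformly among the $\binom{k}{2}$ unordered pairs. Let $H$ be the subgraph of $G$ formed by the edges of colors $c$ and $c'$; its non-trivial components are paths and cycles. Select one of the following: (a) with probability $\frac13$, do nothing; (b)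 with probability $\frac13$, uniformly select a sub-path or a cycle of $H$ from all sub-paths and cycles in $H$; (c) with probability $\frac13$, uniformly select two sub-paths of $H$ from all possible pairs of sub-paths such that both of them have exactly one end vertex which is also an end vertex in $H$. Flip the colors in the selected sub-paths (or cycle). If there is any deficient vertex, select one of them uniformly, then select uniformly one of the edges with the same color incident to the selected vertex and change its color from $c$ to $c'$ or from $c'$ to $c$. Otherwise, with probability $\frac12$ select an edge uniformly from all edges of color $c$ or $c'$ and change its color to the opposite ($c'$ or $c$), and with probability $\frac12$ do nothing. Finally eliminate all deficiencies by flipping the colors on appropriate alternating paths, selecting uniformly from the two edges with the same color incident to a deficient vertex. (3) With probability $\frac14$, select three colors uniformly from all $\binom{k}{3}$ unordered triples, and select uniformly one of the three as distinguished. Let $c''$ be the distinguished color and $c,c'$ the other two. Let $H$ be the subgraph consisting of the edges of colors $c$ and $c'$; its non-trivial components are paths and cycles. Select one of the following: (a) with probability $\frac13$, do nothing; (b) with probability $\frac13$, uniformly select a sub-path of $H$ from all sub-paths such that at least one of its end vertices is not an end vertex in $H$; (c) with probability $\frac13$, uniformly select two sub-paths of $H$ from all possible pairs of sub-paths such that both of them have exactly one end vertex which is also an end vertex in $H$. Flip the colors in the selected sub-paths. If there are two deficient vertices, select one of them uniformly. If there is only one deficient vertex, then with probability $\frac12$ select it, and with probability $\frac12$ select uniformly a non-deficient vertex among those incident to both a $c''$-edge and at least one of a $c$- or a $c'$-edge. If there is no deficient vertex, select uniformly a non-deficient vertex among those incident to both a $c''$-edge and at least one of a $c$- or a $c'$-edge.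 - If a deficient vertex is selected, select uniformly one of the edges with the same color incident to it, and let this color be $\tilde c$. Consider the maximal alternating path or cycle with colors $\tilde c$ and $c''$ containing the selected edge, and flip the colors in it. - If a non-deficient vertex is selected, let $e$ be its incident edge of color $c''$ and $f$ its incident edge of color $c$ or $c'$ (if it has incident edges of both colors, one of them is selected uniformly), and let $\tilde c$ be the color of $f$. Take the maximal alternating path with colors $c''$ and $\tilde c$ that contains $e$ but does not contain $f$, and flip the colors in it. Finally eliminate all deficiencies by flipping the colors on appropriate alternating paths, selecting uniformly from the two edges with the same color incident to a deficient vertex. *)

(* Defs.v *)
From mathcomp Require Import all_boot perm ssralg ssrnum rat.

Set Implicit Arguments.
Unset Strict Implicit.
Unset Printing Implicit Defensive.

Import GRing.Theory.

(** * Finite distributions with rational weights *)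

Section Distributions.

Local Open Scope ring_scope.

Definition dist (T : finType) := T -> rat.

Definition ret (T : finType) (x : T) : dist T := fun y => (y == x)%:R.

Definition bind (T U : finType) (d : dist T) (f : T -> dist U) : dist U :=
  fun y => \sum_x d x * f x y.

Definition unif (T : finType) (A : {set T}) : dist T :=
  fun x => (x \in A)%:R / #|A|%:R.

(* Draw x uniformly from A and continue with f x; when A is empty there is
   nothing to select and the chain goes on with d instead. *)
Definition draw (T U : finType) (A : {set T}) (d : dist U) (f : T -> dist U)
  : dist U :=
  if A == set0 then d else bind (unif A) f.

Definition coin (T : finType) (d1 d2 : dist T) : dist T :=
  fun y => (d1 y + d2 y) / 2%:R.

Definition third (T : finType) (d1 d2 d3 : dist T) : dist T :=
  fun y => (d1 y + d2 y + d3 y) / 3%:R.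

Definition lazy_mix (T : finType) (d1 d2 d3 : dist T) : dist T :=
  fun y => d1 y / 2%:R + d2 y / 4%:R + d3 y / 4%:R.

End Distributions.

(** * Graphs: the edges are 2-element sets of vertices *)

Definition simple_graph (V : finType) (E : {set {set V}}) :=
  forall f, f \in E -> #|f| = 2.

Definition bipartite (V : finType) (E : {set {set V}}) :=
  exists X : {set V}, forall f, f \in E -> #|f :&: X| = 1.

Definition max_degree (V : finType) (E : {set {set V}}) : nat :=
  \max_(v : V) #|[set f in E | v \in f]|.

Notation edge E := {f | f \in E}.

Section Walks.

Context (V : finType) (E : {set {set V}}).

Definition steps (p : seq V) : seq {set V} :=
  if p is x :: s then pairmap (fun y z => [set y; z]) x s else [::].

Definition walk (p : seq V) : bool :=
  (1 < size p) && all (fun f => f \in E) (steps p).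

Definition walk_edges (p : seq V) : seq (edge E) := pmap insub (steps p).

(* Existential quantification over the vertex sequences that may carry a walk
   without repeated edge; such a walk has at most #|E|.+1 vertices. *)
Definition some_seq (P : pred (seq V)) : bool :=
  [exists n : 'I_#|E|.+2, [exists t : n.-tuple V, P t]].

(* Paths (with at least one edge) and cycles inside the edge set H are
   identified with their edge sets, so that a path is not counted once for each
   of its two directions, nor a cycle once for each starting point. *)
Definition subpaths (H : {set edge E}) : {set {set edge E}} :=
  [set F : {set edge E} | (F \subset H) &&
    some_seq (fun p => [&& uniq p, walk p & F == [set f in walk_edges p]])].

Definition subcycles (H : {set edge E}) : {set {set edge E}} :=
  [set F : {set edge E} | (F \subset H) &&
    some_seq (fun p =>
      if p is x :: _ then
        [&& uniq p, 2 < size p, walk (rcons p x)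
          & F == [set f in walk_edges (rcons p x)]]
      else false)].

Definition end_vertices (H : {set edge E}) : {set V} :=
  [set v | #|[set f in H | v \in val f]| == 1].

End Walks.

(** * Colorings and deficiencies *)

Section Colorings.

Context (V : finType) (E : {set {set V}}) (k : nat).

Definition colormap := {ffun edge E -> 'I_k}.

Implicit Types (C : colormap) (a b c d : 'I_k) (f : edge E).

Definition edges_at C (v : V) c : {set edge E} :=
  [set f : edge E | (v \in val f) && (C f == c)].

Definition proper_coloring C : bool :=
  [forall f : edge E, forall g : edge E,
    [&& f != g & val f :&: val g != set0] ==> (C f != C g)].

(* v has a (+a-b)-deficiency *)
Definition deficiency C (v : V) a b : bool :=
  [&& #|edges_at C v a| == 2,
      [forall d, (d != a) ==> (#|edges_at C v d| <= 1)]
    & edges_at C v b == set0].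

Definition deficient C : {set V} :=
  [set v | [exists a, [exists b, deficiency C v a b]]].

Definition repeated_at C (v : V) : {set edge E} :=
  [set f : edge E | (v \in val f) &&
    [exists g : edge E, [&& g != f, v \in val g & C g == C f]]].

Definition flip C a b (F : {set edge E}) : colormap :=
  [ffun f => if f \in F then tperm a b (C f) else C f].

(* A walk without repeated edge, inside the edge set D, whose edges are colored
   a and b alternately; vertices may be repeated. *)
Definition alternating C (D : {set edge E}) a b (p : seq V) : bool :=
  [&& walk E p, uniq (walk_edges E p),
      all (fun f => (f \in D) && (C f \in [:: a; b])) (walk_edges E p)
    & sorted (fun f g => C f != C g) (walk_edges E p)].

(* The alternation continues through the common end point. *)
Definition closing C (p : seq V) : bool :=
  match p, walk_edges E p with
  | x :: s, f :: l => (last x s == x) && (C (last f l) != C f)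
  | _, _ => false
  end.

Definition alternating_cycles C D a b f : {set {set edge E}} :=
  [set F : {set edge E} | (f \in F) &&
    some_seq E (fun p => [&& alternating C D a b p, closing C p
                           & F == [set g in walk_edges E p]])].

(* The edge sets of the maximal alternating (a, b)-walks, or cycles, inside D
   and through f: such a walk either closes up to an alternating cycle through
   f, or contains no such cycle and can be extended at neither of its ends.
   There may be several of them when a deficient vertex is met on the way. *)
Definition maximal_alternating C D a b f : {set {set edge E}} :=
  alternating_cycles C D a b f :|:
  [set F : {set edge E} | [&& f \in F,
      [forall Z in alternating_cycles C D a b f, ~~ (Z \subset F)]
    & some_seq E (fun p =>
        [&& alternating C D a b p,
            ~~ [exists y, alternating C D a b (y :: p)
                          || alternating C D a b (rcons p y)]
          & F == [set g in walk_edges E p]])]].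

Definition flip_maximal C D a b f : dist colormap :=
  draw (maximal_alternating C D a b f) (ret C)
    (fun F => ret (flip C a b F)).

(** * The Markov chain *)

(* Eliminate one (+a-b)-deficiency, drawn among those with both colors in the
   set S of the colors selected for the move. As no b-edge is incident
   to v, an alternating walk through a selected a-edge of v that is maximal
   starts at v with this edge. *)
Definition eliminate1 (S : {set 'I_k}) C : dist colormap :=
  draw [set t : V * 'I_k * 'I_k |
           [&& t.1.2 \in S, t.2 \in S & deficiency C t.1.1 t.1.2 t.2]]
    (ret C)
    (fun t => let: (v, a, b) := t in
       draw (edges_at C v a) (ret C) (flip_maximal C setT a b)).

(* Each elimination decreases the number of deficient vertices, so that #|V|
   rounds suffice; without deficiency a round does nothing. *)
Definition eliminate (S : {set 'I_k}) C : dist colormap :=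
  iter #|V| (fun mu => bind mu (eliminate1 S)) (ret C).

Definition color_class2 C c c' : {set edge E} :=
  [set f : edge E | C f \in [:: c; c']].

Definition flip_choice C c c' (A : {set {set edge E}}) : dist colormap :=
  draw A (ret C) (fun F => ret (flip C c c' F)).

Definition hanging_subpaths (H : {set edge E}) : {set {set edge E}} :=
  [set F in subpaths H | #|end_vertices F :&: end_vertices H| == 1].

(* Ordered pairs of distinct sub-paths give the same law as unordered ones. *)
Definition flip_pair C c c' : dist colormap :=
  let P := hanging_subpaths (color_class2 C c c') in
  draw [set q : {set edge E} * {set edge E} |
           [&& q.1 \in P, q.2 \in P & q.1 != q.2]]
    (ret C)
    (fun q => ret (flip (flip C c c' q.1) c c' q.2)).

Definition recolor2 c c' C : dist colormap :=
  let change f := ret (flip C c c' [set f]) in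
  if deficient C != set0 then
    draw (deficient C) (ret C)
      (fun v => draw (repeated_at C v) (ret C) change)
  else
    coin (draw (color_class2 C c c') (ret C) change) (ret C).

Definition two_color_move C c c' : dist colormap :=
  let H := color_class2 C c c' in
  bind
    (bind
      (third (ret C)
             (flip_choice C c c' (subpaths H :|: subcycles H))
             (flip_pair C c c'))
      (recolor2 c c'))
    (eliminate [set c; c']).

Definition flip_at_deficient c'' C : dist colormap :=
  draw (deficient C) (ret C)
    (fun v => draw (repeated_at C v) (ret C)
       (fun f => flip_maximal C setT (C f) c'' f)).

Definition flip_at_nondeficient c c' c'' C : dist colormap :=
  draw [set v | [&& v \notin deficient C, edges_at C v c'' != set0
                    & edges_at C v c :|: edges_at C v c' != set0]]
    (ret C)
    (fun v => draw (edges_at C v c'') (ret C)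
       (fun e => draw (edges_at C v c :|: edges_at C v c') (ret C)
          (fun f => flip_maximal C [set~ f] c'' (C f) e))).

Definition recolor3 c c' c'' C : dist colormap :=
  match #|deficient C| with
  | 0 => flip_at_nondeficient c c' c'' C
  | 1 => coin (flip_at_deficient c'' C) (flip_at_nondeficient c c' c'' C)
  | _ => flip_at_deficient c'' C
  end.

Definition three_color_move C c c' c'' : dist colormap :=
  let H := color_class2 C c c' in
  bind
    (bind
      (third (ret C)
             (flip_choice C c c'
                [set F in subpaths H |
                  ~~ (end_vertices F \subset end_vertices H)])
             (flip_pair C c c'))
      (recolor3 c c' c''))
    (eliminate [set c; c'; c'']).

(* The moves are symmetric in c and c', so that drawing ordered tuples of
   distinct colors is the same as drawing an unordered pair, respectively an
   unordered triple with a distinguished element c''. *)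
Definition chain_step C : dist colormap :=
  lazy_mix
    (ret C)
    (draw [set q : 'I_k * 'I_k | q.1 != q.2] (ret C)
       (fun q => two_color_move C q.1 q.2))
    (draw [set q : 'I_k * 'I_k * 'I_k | uniq [:: q.1.1; q.1.2; q.2]] (ret C)
       (fun q => three_color_move C q.1.1 q.1.2 q.2)).

End Colorings.

(* The states of M(G, k) *)
Definition edge_coloring (V : finType) (E : {set {set V}}) (k : nat) :=
  {C : colormap E k | proper_coloring C}.

Definition transition (V : finType) (E : {set {set V}}) (k : nat)
    (C C' : edge_coloring E k) : rat :=
  chain_step (val C) (val C').

(* Main.v *)
(* The classes of C2 are settled one color a at a time, the edges already settled
   keeping their colors (the set S); class a, with M its edges in C2, costs at
   most 6|M| steps.

   An edge of M that still has a color of S has, by counting, a color outside S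
   missing at each of its ends; a Kempe flip makes the same color missing at
   both, and the edge takes it: two steps.  Then a wrong edge of M, of color b,
   is recolored a.  This creates (+a-b)-deficiencies at its ends.  At such a
   vertex the a-edge outside M is recolored b, which moves the deficiency to its
   other end w and turns it into (+b-a).  If the M-edge at w has color b it is
   recolored a; if it has color d, it is given color b beforehand by flipping
   the maximal (b, d)-walk through one of the two b-edges at w; if w has no
   M-edge, a similar flip with a color d missing at w resolves the deficiency.
   All deficiencies thus keep the same two colors a and b, provided the flip
   avoids the other deficient vertex u; since u is on the side of w, parity
   leaves at most one of the two choices at w reaching u.

   The almost colorings D so obtained are shadowed by proper colorings C, where C
   arises from D by elimination and D from C by the opening sub-path flips. *)

Require Import Defs.
From mathcomp Require Import all_boot order perm ssralg ssrnum rat.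

Set Implicit Arguments.
Unset Strict Implicit.
Unset Printing Implicit Defensive.

Import GRing.Theory Num.Theory.

(** The constant 6 is 2 + 4. Freeing an edge of M from a settled color costs 2. A run starts at one
    wrong edge and needs at most 3 steps for each further one: recolor an a-edge b, bring the color
    b to the M-edge at w, recolor that edge a. The first recoloring of a run costs no step when it
    creates a deficiency, being then a legal opening sub-path flip; the share 3 of its edge, plus 1,
    pays for the two deficiencies it may leave, worth 2 each. So a run that puts r edges right takes
    at most 3r + 1 steps, hence at most 4r.

    The side condition behind the parity argument comes from the start: the two deficiencies are at
    the ends of one edge, on opposite sides. One waits while the other crosses one edge at each
    change of its sign, so the sides agree exactly while the moving one is (+b-a).

    An M-edge that has received a keeps it: recoloring a to b happens outside M, and the (b,
    d)-flips leave a alone. Hence the number of wrong edges never grows. *)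

Section Supports.

Local Open Scope ring_scope.

(** * Positivity of weights: one favorable branch suffices when all weights are nonnegative *)

Definition nneg (T : finType) (d : dist T) := forall x, 0 <= d x.

Lemma ret_nneg (T : finType) (x : T) : nneg (ret x).
Proof. by move=> y; rewrite /ret ler0n. Qed.

Lemma ret_pos (T : finType) (x : T) : 0 < ret x x.
Proof. by rewrite /ret eqxx ltr01. Qed.

Lemma bind_nneg (T U : finType) (d : dist T) (f : T -> dist U) :
  nneg d -> (forall x, nneg (f x)) -> nneg (bind d f).
Proof. by move=> dP fP y; apply: sumr_ge0 => x _; rewrite mulr_ge0 ?fP. Qed.

Lemma bind_pos (T U : finType) (d : dist T) (f : T -> dist U) x y :
  nneg d -> (forall x, nneg (f x)) -> 0 < d x -> 0 < f x y -> 0 < bind d f y.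
Proof.
move=> dP fP dx fy; rewrite /bind (bigD1 x) //=.
apply: ltr_wpDr; last exact: mulr_gt0.
by apply: sumr_ge0 => z _; rewrite mulr_ge0 ?fP.
Qed.

Lemma unif_nneg (T : finType) (A : {set T}) : nneg (unif A).
Proof. by move=> x; rewrite /unif divr_ge0 ?ler0n. Qed.

Lemma draw_nneg (T U : finType) (A : {set T}) (d : dist U) (f : T -> dist U) :
  nneg d -> (forall x, nneg (f x)) -> nneg (draw A d f).
Proof.
move=> dP fP; rewrite /draw; case: ifP => // _.
by apply: bind_nneg => //; apply: unif_nneg.
Qed.

Lemma draw_pos (T U : finType) (A : {set T}) (d : dist U) (f : T -> dist U) x y :
  (forall x, nneg (f x)) -> x \in A -> 0 < f x y -> 0 < draw A d f y.
Proof.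
move=> fP xA fy; rewrite /draw; case: eqP => [A0|_]; first by rewrite A0 inE in xA.
apply: bind_pos fy => //; first exact: unif_nneg.
by rewrite /unif xA divr_gt0 ?ltr01 // ltr0n; apply/card_gt0P; exists x.
Qed.

Lemma coin_nneg (T : finType) (d1 d2 : dist T) :
  nneg d1 -> nneg d2 -> nneg (coin d1 d2).
Proof. by move=> ? ? x; rewrite /coin divr_ge0 ?addr_ge0 ?ler0n. Qed.

Lemma coin_posl (T : finType) (d1 d2 : dist T) x :
  nneg d2 -> 0 < d1 x -> 0 < coin d1 d2 x.
Proof. by move=> P2 d1x; rewrite /coin divr_gt0 ?ltr0n // ltr_wpDr. Qed.

Lemma coin_posr (T : finType) (d1 d2 : dist T) x :
  nneg d1 -> 0 < d2 x -> 0 < coin d1 d2 x.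
Proof. by move=> P2 d1x; rewrite /coin divr_gt0 ?ltr0n // ltr_wpDl. Qed.

Lemma third_nneg (T : finType) (d1 d2 d3 : dist T) :
  nneg d1 -> nneg d2 -> nneg d3 -> nneg (third d1 d2 d3).
Proof. by move=> ? ? ? x; rewrite /third divr_ge0 ?addr_ge0 ?ler0n. Qed.

Lemma third_pos (T : finType) (d1 d2 d3 : dist T) x :
  nneg d1 -> nneg d2 -> nneg d3 ->
  [\/ 0 < d1 x, 0 < d2 x | 0 < d3 x] -> 0 < third d1 d2 d3 x.
Proof.
move=> P1 P2 P3 H; rewrite /third divr_gt0 ?ltr0n //.
case: H => H; first by apply: ltr_wpDr => //; apply: ltr_wpDr.
  by apply: ltr_wpDr => //; apply: ltr_wpDl.
by apply: ltr_wpDl => //; apply: addr_ge0.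
Qed.

Lemma lazy_mix_pos (T : finType) (d1 d2 d3 : dist T) x :
  nneg d1 -> nneg d2 -> nneg d3 ->
  0 < d2 x \/ 0 < d3 x -> 0 < lazy_mix d1 d2 d3 x.
Proof.
move=> P1 P2 P3 H; rewrite /lazy_mix.
have h n (d : dist T) : nneg d -> 0 <= d x / n%:R :> rat by move=> ?; rewrite divr_ge0.
have h' n (d : dist T) : (0 < n)%N -> 0 < d x -> 0 < d x / n%:R :> rat.
  by move=> ? ?; rewrite divr_gt0 ?ltr0n.
case: H => H; first by apply: ltr_wpDr; rewrite ?h // ltr_wpDl ?h ?h'.
by apply: ltr_wpDl; rewrite ?addr_ge0 ?h ?h'.
Qed.

End Supports.

(** * Alternating paths *)

Section Trails.

Context (V : finType) (E : {set {set V}}).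
Implicit Types (x y z v : V) (s : seq V) (e f g h : edge E) (es : seq (edge E)).

(** The edges are carried along with the vertices, since [walk_edges] recovers them only through
    [insub]; inductions then run on both lists at once. *)
Fixpoint trail x s es : bool :=
  match s, es with
  | [::], [::] => true
  | y :: s', e :: es' => (val e == [set x; y]) && trail y s' es'
  | _, _ => false
  end.

Lemma trail_size x s es : trail x s es -> size es = size s.
Proof. by elim: s x es => [|y s IH] x [|e es] //= /andP[_ /IH ->]. Qed.

Lemma trail_walk_edges x s es : trail x s es -> walk_edges E (x :: s) = es.
Proof.
elim: s x es => [|y s IH] x [|e es] //= /andP[/eqP exy /IH].
by rewrite /walk_edges /= -exy valK /= => ->.
Qed.

Lemma trail_walk x s es : trail x s es -> s != [::] -> walk E (x :: s).
Proof.
move=> tr s0; rewrite /walk; case: s s0 tr => // y s _ tr /=.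
elim: s x y es tr => [|z s IH] x y [|e es] //= /andP[/eqP <- tr].
  by rewrite (valP e).
by rewrite (valP e) (IH _ _ _ tr).
Qed.

Lemma walk_trail x s : walk E (x :: s) -> trail x s (walk_edges E (x :: s)).
Proof.
case/andP=> _; elim: s x => [|y s IH] x //= /andP[xy /IH tr].
by rewrite /walk_edges /= (insubT (mem E) xy) /= eqxx.
Qed.

Lemma trail_mem x s es e v : trail x s es -> e \in es -> v \in val e -> v \in x :: s.
Proof.
elim: s x es => [|y s IH] x [|f es] //= /andP[/eqP fxy tr]; rewrite inE.
case/orP=> [/eqP-> |ees ve]; last by rewrite inE (IH _ _ tr ees ve) orbT.
by rewrite fxy !inE => /orP[->|->]; rewrite ?orbT.
Qed.

Lemma trail_head x s es e e0 :
  trail x s es -> uniq (x :: s) -> e \in es -> x \in val e -> e = head e0 es.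
Proof.
case: s es => [|y s] [|f es] //= /andP[/eqP fxy tr] /andP[xs _].
rewrite inE => /orP[/eqP-> //|ees xe].
by rewrite (trail_mem tr ees xe) in xs.
Qed.

Lemma trail_split x s1 s2 es : trail x (s1 ++ s2) es ->
  exists es1 es2, [/\ es = es1 ++ es2, trail x s1 es1 & trail (last x s1) s2 es2].
Proof.
elim: s1 x es => [|y s IH] x es /= tr; first by exists [::], es.
case: es tr => [|e es] //= /andP[exy /IH[es1 [es2 [-> tr1 tr2]]]].
by exists (e :: es1), es2; rewrite /= exy.
Qed.

Lemma trail_rcons x s es y e :
  trail x (rcons s y) (rcons es e) = trail x s es && (val e == [set last x s; y]).
Proof.
elim: s x es => [|z s IH] x [|f es] //=; rewrite ?andbT //.
- by case: es => [|g es] /=; rewrite ?andbF.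
- by rewrite andbC; case: s {IH} => [|z' s] //=; rewrite andbF.
by rewrite IH andbA.
Qed.

Lemma trail_rev x s es :
  trail x s es -> trail (last x s) (rev (belast x s)) (rev es).
Proof.
elim: s x es => [|y s IH] x [|e es] //= /andP[/eqP exy /IH tr].
rewrite !rev_cons trail_rcons tr; apply/eqP; rewrite (exy : val e = _) setUC;
  congr [set _; _].
case: s {IH tr} => //= z s; by rewrite rev_cons last_rcons.
Qed.

Lemma rev_belast x s : last (last x s) (rev (belast x s)) = x.
Proof. by case: s => //= y s; rewrite rev_cons last_rcons. Qed.

End Trails.

Section Alternation.

Context (V : finType) (E : {set {set V}}) (k : nat) (side : V -> bool).
Context (edge_ends : forall e : edge E, exists x y, val e = [set x; y]).
Context (side_edge :
  forall (e : edge E) x y, val e = [set x; y] -> side x != side y).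

Implicit Types (x y z v : V) (s : seq V) (e f g h : edge E) (es : seq (edge E)).
Implicit Types (C : colormap E k) (K : {set edge E}) (p q : 'I_k).

Lemma edge_other e v : v \in val e -> exists z, val e = [set v; z].
Proof.
have [x [y ->]] := edge_ends e; rewrite !inE => /orP[]/eqP->; first by exists y.
by exists x; rewrite setUC.
Qed.

Definition two_colored C K :=
  forall e g h, e \in K -> g \in K -> h \in K ->
    C g != C e -> C h != C e -> C g = C h.

(* Alternating walks in K can be prolonged in at most one way. *)
Definition forced C K := forall v e g h,
  e \in K -> g \in K -> h \in K -> v \in val e -> v \in val g -> v \in val h ->
  C g != C e -> C h != C e -> g = h.

Definition altpath C K x s es :=
  [&& trail x s es, uniq (x :: s), all (mem K) es
    & sorted (fun e g => C e != C g) es].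

Lemma altpath_trail C K x s es : altpath C K x s es -> trail x s es.
Proof. by case/and4P. Qed.

Lemma altpath_in C K x s es e : altpath C K x s es -> e \in es -> e \in K.
Proof. by case/and4P=> _ _ /allP H _ /H. Qed.

Lemma altpath_cons C K x y s e es : altpath C K x (y :: s) (e :: es) ->
  [/\ val e = [set x; y], x \notin y :: s, e \in K, altpath C K y s es
    & path (fun e g => C e != C g) e es].
Proof.
case/and4P=> /= /andP[/eqP exy tr] /andP[xs us] /andP[eK aK] pth.
by split=> //; apply/and4P; split=> //; apply: path_sorted pth.
Qed.

Lemma altpath_rev C K x s es : altpath C K x s es ->
  altpath C K (last x s) (rev (belast x s)) (rev es).
Proof.
case/and4P=> tr us aK srt; apply/and4P; split.
- exact: trail_rev.
- by rewrite -rev_rcons rev_uniq -lastI.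
- by rewrite all_rev.
by rewrite rev_sorted (eq_sorted (e' := fun e g => C e != C g)) // => e g; rewrite eq_sym.
Qed.

Lemma altpath_suffix C K x s1 s2 es : altpath C K x (s1 ++ s2) es ->
  exists es1 es2, [/\ es = es1 ++ es2, altpath C K x s1 es1
                    & altpath C K (last x s1) s2 es2].
Proof.
case/and4P=> tr us aK srt.
have [es1 [es2 [def_es tr1 tr2]]] := trail_split tr.
move: aK srt; rewrite def_es all_cat => /andP[aK1 aK2] srt.
exists es1, es2; split=> //; apply/and4P; split=> //.
- by move: us; rewrite -cat_cons cat_uniq => /andP[].
- by case/cat_sorted2: srt.
- by move: us; rewrite -cat_cons lastI cat_rcons cat_uniq => /and3P[].
by case/cat_sorted2: srt.
Qed.

(** Each edge changes the side, and each further edge changes the color, so both sides of the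
    equation say that the number of edges is even. *)
Lemma altpath_side C K x s es e0 : two_colored C K -> altpath C K x s es ->
  es != [::] ->
  (side (last x s) == side x) = (C (last e0 es) != C (head e0 es)).
Proof.
move=> tc; elim: s x es => [|y s IH] x [|e es] // ap _.
have [exy _ eK ap' pth] := altpath_cons ap.
have sxy := side_edge exy.
case: es ap' pth {ap} => [|g es] ap'.
  by case: s {IH} ap' => [|z s] /=;
    rewrite ?eqxx ?(eq_sym (side y)) ?(negPf sxy) // => /and4P[].
case/andP=> Ceg _; have {IH} := IH _ _ ap' isT.
rewrite /= => IH; have lK : last g es \in K.
  by apply: (altpath_in ap'); rewrite mem_last.
have gK : g \in K by apply: (altpath_in ap'); rewrite mem_head.
case: (C (last g es) =P C g) IH => [-> | /eqP lg] /eqP.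
  rewrite (eq_sym (C g)) Ceg; case: (side (last y s)) sxy; case: (side x);
    case: (side y) => //.
have -> : C (last g es) = C e by apply: (tc g).
by rewrite eqxx; case: (side (last y s)) sxy; case: (side x); case: (side y) => //.
Qed.

(* An edge back into the path contradicts determinism unless it joins the two
   ends; bipartiteness then excludes an odd closed walk. *)
Lemma altpath_head C K x s es h : two_colored C K -> forced C K ->
  altpath C K x s es -> es != [::] ->
  (forall z e, ~~ altpath C K z (x :: s) (e :: es)) ->
  h \in K -> x \in val h -> C h != C (head h es) ->
  val h = [set last x s; x] /\ C h != C (last h es).
Proof.
move=> tc fo ap es0 stop hK xh Ch.
have [z hxz] := edge_other xh.
have xz := side_edge hxz.
case: (boolP (z \in x :: s)) => [|zs]; last first.
  case/negP: (stop z h); case/and4P: (ap) => tr us aK srt.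
  apply/and4P; split; rewrite //= ?hK //.
  - by rewrite hxz setUC eqxx.
  - by rewrite zs.
  by case: es es0 Ch srt {ap tr aK stop} => //= g es _ -> ->.
rewrite inE => /orP[/eqP zx|zs]; first by rewrite zx eqxx in xz.
case: (z =P last x s) => [zl|zl].
  split; first by rewrite hxz zl setUC.
  have := altpath_side h tc ap es0; rewrite -zl eq_sym (negPf xz).
  by move/esym/negbFE/eqP->.
case/path.splitP: zs ap zl => s1 s2 ap; rewrite cat_rcons in ap.
rewrite -cats1 -catA /= in ap *.
have [es1 [es2 [def_es ap1 ap2]]] := altpath_suffix ap.
rewrite last_cat /=; case: s2 ap ap2 => [|t s2] ap ap2 //= _.
case: es2 ap2 def_es => [|e1 [|e2 es2]] ap2; try by case/and4P: ap2; rewrite /= ?andbF.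
move=> def_es.
have [e1v _ e1K ap3 /andP[C12 _]] := altpath_cons ap2.
have [e2v zts e2K ap4 _] := altpath_cons ap3.
have us : uniq (x :: s1 ++ z :: t :: s2) by case/and4P: ap.
have xns : x \notin s1 ++ z :: t :: s2 by case/andP: us.
have zh : z \in val h by rewrite hxz !inE eqxx orbT.
have ze1 : z \in val e1 by rewrite e1v !inE eqxx orbT.
have ze2 : z \in val e2 by rewrite e2v !inE eqxx.
(* [z] is an inner vertex with path edges [e1] and [e2] of different colors, so determinism
   identifies [h] with one of them. If it is [e2], then [x] occurs again on the path; if it is [e1],
   then [x] precedes [z], so [e1] is the head edge and [h] does not differ from it in color. *)
case: (C h =P C e2) => [he2|/eqP he2].
  have he : h = e2 by apply: (fo z e1) => //; rewrite ?he2 eq_sym.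
  move: xh; rewrite he e2v !inE => /orP[/eqP xz'|/eqP xt].
    by rewrite xz' eqxx in xz.
  by move: xns; rewrite xt mem_cat !inE eqxx !orbT.
have he : h = e1 by apply: (fo z e2) => //.
move: xh; rewrite he e1v !inE => /orP[/eqP xl|/eqP xz']; last by rewrite xz' eqxx in xz.
move: Ch; rewrite def_es he; case: es1 ap1 {def_es} => [|e0 es1] ap1 /=;
  first by rewrite eqxx.
case: s1 ap1 xl xns {ap us ap2 e1v} => [|y s1]; first by case/and4P.
move=> ap1 /= -> ; rewrite inE mem_cat.
by have := mem_last y s1; rewrite inE => /orP[/eqP->|->]; rewrite ?eqxx ?orbT.
Qed.

Definition closes C K x s es h :=
  [/\ h \in K, val h = [set last x s; x], C h != C (head h es)
    & C h != C (last h es)].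

(** No edge of [K] continues the alternation at either end. Here [K] may be larger than the set in
    which the path itself was built. *)
Definition dead_ends C K x s es :=
  (forall h, h \in K -> x \in val h -> C h = C (head h es)) /\
  (forall h, h \in K -> last x s \in val h -> C h = C (last h es)).

(** Prolong at either end as long as possible; distinct vertices bound the length by [#|V|]. When
    stuck, an edge that would continue the alternation must join the two ends, by [altpath_head]
    applied to the path or to its reverse. *)
Lemma altpath_maximal C K x s es f : two_colored C K -> forced C K ->
  altpath C K x s es -> f \in es ->
  exists x' s' es', [/\ altpath C K x' s' es', f \in es'
    & (exists h, closes C K x' s' es' h) \/ dead_ends C K x' s' es'].
Proof.
move=> tc fo; have [n] := ubnP (#|V| - size s).
elim: n x s es => // n IH x s es; rewrite ltnS => len ap fes.
have es0 : es != [::] by case: es fes {ap}.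
have szV : size s < #|V|.
  case/and4P: ap => _ us _ _.
  by have := max_card (mem (x :: s)); rewrite (card_uniqP us).
case: (boolP [exists z, exists e, altpath C K z (x :: s) (e :: es)]) => [|noh].
  case/existsP=> z /existsP[e ap']; apply: IH ap' _; last by rewrite inE fes orbT.
  by rewrite /=; apply: leq_trans len; rewrite ltn_sub2l.
case: (boolP [exists z, exists e, altpath C K z (last x s :: rev (belast x s)) (e :: rev es)]) => [|nol].
  case/existsP=> z /existsP[e ap'].
  apply: IH ap' _; last by rewrite inE mem_rev fes orbT.
  by rewrite /= size_rev size_belast; apply: leq_trans len; rewrite ltn_sub2l.
have stoph z e : ~~ altpath C K z (x :: s) (e :: es).
  by apply: contra noh => H; apply/existsP; exists z; apply/existsP; exists e.
have stopl z e : ~~ altpath C K z (last x s :: rev (belast x s)) (e :: rev es).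
  by apply: contra nol => H; apply/existsP; exists z; apply/existsP; exists e.
exists x, s, es; split=> //.
case: (boolP [exists h, [&& h \in K, x \in val h & C h != C (head h es)]]).
  case/existsP=> h /and3P[hK xh Ch]; left; exists h.
  by have [] := altpath_head tc fo ap es0 stoph hK xh Ch.
rewrite negb_exists => /forallP Hh.
case: (boolP [exists h, [&& h \in K, last x s \in val h & C h != C (last h es)]]).
  case/existsP=> h /and3P[hK xh Ch]; left; exists h.
  have hd : head h (rev es) = last h es.
    by case: (lastP es) => // ? ?; rewrite rev_rcons last_rcons.
  have lt : last h (rev es) = head h es.
    by case: es {ap fes es0 len noh nol stoph stopl Hh Ch hd} => //= ? ?;
      rewrite rev_cons last_rcons.
  have [] := altpath_head tc fo (altpath_rev ap) _ stopl hK xh _.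
  - by rewrite -size_eq0 size_rev size_eq0.
  - by rewrite hd.
  by rewrite rev_belast lt setUC; split.
rewrite negb_exists => /forallP Hl; right; split=> h hK xh.
  by have := Hh h; rewrite hK xh /= negbK => /eqP.
by have := Hl h; rewrite hK xh /= negbK => /eqP.
Qed.

Lemma altpath_component C K f : two_colored C K -> forced C K -> f \in K ->
  exists x s es, [/\ altpath C K x s es, f \in es
    & (exists h, closes C K x s es h) \/ dead_ends C K x s es].
Proof.
move=> tc fo fK.
have [v [z fvz]] := edge_ends f.
apply: (@altpath_maximal _ _ v [:: z] [:: f]) => //; last exact: mem_head.
rewrite /altpath /= fvz eqxx fK !inE !andbT; apply/eqP=> vz.
by have := side_edge fvz; rewrite vz eqxx.
Qed.

End Alternation.

(** * Edge sets of alternating paths and cycles, and their maximality for the chain *)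

Section Components.

Context (V : finType) (E : {set {set V}}) (k : nat).

Implicit Types (x y z v : V) (s : seq V) (e f g h : edge E) (es : seq (edge E)).
Implicit Types (C : colormap E k) (K F H : {set edge E}) (p q : 'I_k).

(** The local form of being a union of alternating components. It is stated per vertex because the
    flips of the three-color moves are closed everywhere except possibly at the deficient vertex. *)
Definition closed_at C K F v := forall e g, e \in F -> g \in K ->
  v \in val e -> v \in val g -> C g != C e -> g \in F.

Lemma altpath_head_eq C K x s es e e0 : altpath C K x s es ->
  e \in es -> x \in val e -> e = head e0 es.
Proof. by case/and4P=> tr us _ _; exact: (trail_head e0 tr us). Qed.

Lemma altpath_inner C K x s es e v : altpath C K x s es -> e \in es ->
  v \in val e ->
  [\/ v = x /\ e = head e es, v = last x s /\ e = last e es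
    | exists g, [/\ g \in es, v \in val g & C g != C e]].
Proof.
elim: s x es => [|y s IH] x [|e1 es] ap //.
have [e1xy xs e1K ap' pth] := altpath_cons ap.
rewrite inE => /orP[/eqP->|ees].
  rewrite e1xy !inE => /orP[/eqP->|/eqP->]; first by constructor 1.
  case: s es {IH ap} ap' pth {xs} => [|z s] [|g es] //= ap' pth.
  - by constructor 2.
  constructor 3; exists g; have [gyz _ _ _ _] := altpath_cons ap'.
  split; [by rewrite !inE eqxx orbT | by rewrite gyz !inE eqxx |].
  by rewrite eq_sym; case/andP: pth.
case/(IH _ _ ap' ees)=> [[-> eh]|[-> el]|[g [ges vg Cg]]].
- constructor 3; exists e1; split; [exact: mem_head | by rewrite e1xy !inE eqxx orbT |].
  by rewrite eh; case: es pth ees {ap ap' eh} => //= a l /andP[].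
- constructor 2; split=> //=; rewrite {1}el; case: es ees {ap ap' pth el} => //=.
- by constructor 3; exists g; rewrite inE ges orbT.
Qed.

Lemma trail_ends x s es h : trail x s es -> es != [::] ->
  x \in val (head h es) /\ last x s \in val (last h es).
Proof.
case: s es => [|y s] [|e es] // tr _; split.
  by case/andP: tr => /eqP /= -> _; rewrite !inE eqxx.
elim: s x y e es tr => [|z s IH] x y e [|g es] //=.
- by rewrite andbT => /eqP->; rewrite !inE eqxx orbT.
- by rewrite andbF.
- by rewrite andbF.
by case/andP=> _ /IH.
Qed.

Lemma closed_path C K x s es v : forced C K -> altpath C K x s es ->
  dead_ends C K x s es -> closed_at C K [set e in es] v.
Proof.
move=> fo ap [dx dl] e g; rewrite !inE => ees gK ve vg Cge.
have eK := altpath_in ap ees.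
case: (altpath_inner ap ees ve) => [[vx eh]|[vl el]|[g' [g's vg' Cg']]].
- by move: Cge; rewrite vx in vg; rewrite (dx g gK vg) eh;
    case: es ees {ap dx dl eh eK} => //= a l _; rewrite eqxx.
- by move: Cge; rewrite vl in vg; rewrite (dl g gK vg) el;
    case: es ees {ap dx dl el eK} => //= a l _; rewrite eqxx.
by rewrite (fo v e g g') //; apply: altpath_in ap g's.
Qed.

Lemma cycle_opposite C K x s es h e v : altpath C K x s es ->
  closes C K x s es h -> e \in h :: es -> v \in val e ->
  exists g, [/\ g \in h :: es, v \in val g & C g != C e].
Proof.
move=> ap [hK hv Ch Cl].
have es0 : es != [::] by apply: contraNneq Ch => ->.
have hes : head h es \in es /\ last h es \in es.
  by case: es es0 {ap Ch Cl} => //= a l _; rewrite mem_head mem_last.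
have [xh ll] := trail_ends h (altpath_trail ap) es0.
rewrite inE => /orP[/eqP->|ees].
  rewrite hv !inE => /orP[]/eqP->.
    by exists (last h es); rewrite inE hes.2 orbT eq_sym.
  by exists (head h es); rewrite inE hes.1 orbT eq_sym.
move=> ve; have hd d : head d es = head h es by case: (es) es0.
have lt d : last d es = last h es by case: (es) es0.
case: (altpath_inner ap ees ve) => [[-> ->]|[-> ->]|[g [gs vg Cg]]].
- by exists h; rewrite mem_head hd hv !inE eqxx orbT.
- by exists h; rewrite mem_head lt hv !inE eqxx.
by exists g; rewrite inE gs orbT.
Qed.

Lemma trail_uniq x s es : trail x s es -> uniq (x :: s) -> uniq es.
Proof.
elim: s x es => [|y s IH] x [|e es] // tr /andP[xs us].
case/andP: tr => /eqP exy tr; rewrite /= (IH _ _ tr us) andbT.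
apply: contra xs => /(trail_mem tr); apply.
by rewrite exy !inE eqxx.
Qed.

Lemma uniq_edges_size es : uniq es -> size es <= #|E|.
Proof.
by move=> ues; have := max_card (mem es); rewrite (card_uniqP ues) card_sig.
Qed.

Lemma some_seqI (P : pred (seq V)) s : size s < #|E|.+2 -> P s -> some_seq E P.
Proof.
move=> sz Ps; apply/existsP; exists (Ordinal sz); apply/existsP.
by exists (in_tuple s).
Qed.

Lemma subpath_altpath C K H x s es : altpath C K x s es -> es != [::] ->
  [set e in es] \subset H -> [set e in es] \in subpaths H.
Proof.
case/and4P=> tr us _ _ es0 sub; rewrite inE sub /=.
have s0 : s != [::] by case: s tr {us} => //; case: es es0 {sub}.
apply: (@some_seqI _ (x :: s)).
  by rewrite /= !ltnS -(trail_size tr) uniq_edges_size // (trail_uniq tr us).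
by rewrite us (trail_walk tr s0) (trail_walk_edges tr) eqxx.
Qed.

Lemma altpath_ends C K x s es : altpath C K x s es -> es != [::] ->
  end_vertices [set e in es] = [set x; last x s].
Proof.
move=> ap es0; apply/setP=> v; rewrite !inE.
have hx : exists2 e, e \in es & x \in val e.
  case: es ap es0 => // e es ap _; exists e; first exact: mem_head.
  by have [] := trail_ends e (altpath_trail ap) isT.
have hl : exists2 e, e \in es & last x s \in val e.
  case: es ap es0 {hx} => // e es ap _; exists (last e es); first exact: mem_last.
  by have [] := trail_ends e (altpath_trail ap) isT.
have one u e : e \in es -> u \in val e ->
    (forall g, g \in es -> u \in val g -> g = e) ->
    #|[set f in [set e0 in es] | u \in val f]| == 1.
  move=> ees ue H; apply/cards1P; exists e; apply/setP=> g; rewrite !inE.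
  apply/andP/eqP => [[gs ug]|->]; [exact: H | by split].
apply/idP/idP => [/cards1P[e de]|/orP[]/eqP->].
- have: e \in [set e] by rewrite inE.
  rewrite -de !inE => /andP[ees ve].
  case: (altpath_inner ap ees ve) => [[-> _]|[-> _]|[g [gs vg Cg]]];
    rewrite ?eqxx ?orbT //.
  have: g \in [set e] by rewrite -de !inE gs.
  by rewrite inE => /eqP ge; rewrite ge eqxx in Cg.
- case: hx => e ees xe; apply: (one _ e) => // g gs xg.
  by rewrite (altpath_head_eq e ap ees xe); apply: altpath_head_eq ap gs xg.
case: hl => e ees le; apply: (one _ e) => // g gs lg.
have ap' := altpath_rev ap; rewrite -mem_rev in ees; rewrite -mem_rev in gs.
by rewrite (altpath_head_eq e ap' ees le); apply: altpath_head_eq ap' gs lg.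
Qed.

Lemma altpath_alternating C K x s es p q : altpath C K x s es -> es != [::] ->
  K \subset color_class2 C p q -> alternating C setT p q (x :: s).
Proof.
case/and4P=> tr us /allP aK srt es0 /subsetP KS.
have s0 : s != [::] by case: s tr {us} => //; case: es es0 {srt aK}.
rewrite /alternating (trail_walk tr s0) (trail_walk_edges tr) (trail_uniq tr us) srt andbT /=.
by apply/allP=> e /aK/KS; rewrite !inE.
Qed.

Lemma cycle_alternating C K x s es h f p q : altpath C K x s es ->
  closes C K x s es h -> K \subset color_class2 C p q -> f \in h :: es ->
  [set e in h :: es] \in alternating_cycles C setT p q f.
Proof.
move=> ap [hK hv Ch Cl] KS fF; rewrite !inE in fF *; rewrite fF /=.
case/and4P: (ap) => tr us /allP aK srt.
have es0 : es != [::] by apply: contraNneq Ch => ->.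
have hes : h \notin es.
  apply: contraNN Ch => hes; apply/eqP; congr (C _).
  by apply: altpath_head_eq ap hes _; rewrite hv !inE eqxx orbT.
have tr' : trail x (rcons s x) (rcons es h) by rewrite trail_rcons tr hv eqxx.
have ues := trail_uniq tr us.
apply: (@some_seqI _ (x :: rcons s x)).
  rewrite /= size_rcons -(trail_size tr) !ltnS.
  by have := @uniq_edges_size (h :: es); rewrite /= hes ues => ->.
have we := trail_walk_edges tr'.
have Ke e : e \in K -> C e \in [:: p; q] by move/(subsetP KS); rewrite !inE.
apply/and3P; split.
- rewrite /alternating (trail_walk tr') ?we; last by case: (s).
  rewrite rcons_uniq hes ues /=; apply/andP; split.
    apply/allP=> e; rewrite mem_rcons inE => /orP[/eqP->|/aK eK].
      by rewrite in_setT Ke.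
    by rewrite in_setT Ke.
  case: es es0 srt Cl {ap Ch aK fF tr hes tr' ues we} => //= a l _ srt Cl.
  by rewrite rcons_path srt eq_sym.
- rewrite /closing we; case: es es0 Ch {ap Cl aK srt fF tr hes tr' ues we} =>
    //= a l _ Ch.
  by rewrite !last_rcons eqxx.
by rewrite we; apply/eqP/setP=> e; rewrite !inE mem_rcons inE.
Qed.

(** Extracts from the cycles in the definition of the chain the one local property needed to show
    that no path contains such a cycle. *)
Lemma closing_opposite C D p q f Z e v : Z \in alternating_cycles C D p q f ->
  e \in Z -> v \in val e -> exists g, [/\ g \in Z, v \in val g & C g != C e].
Proof.
rewrite inE => /andP[_ /existsP[n /existsP[t]]].
move: (tval t) => s /and3P[/and4P[wk ue _ srt] cl /eqP ->] {n t}.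
case: s wk ue srt cl => [|x s] // wk; have := walk_trail wk.
rewrite /closing; move: (walk_edges E (x :: s)) => es tr ue srt.
case: es tr ue srt => // a l tr ue srt /andP[/eqP lx Cl]; rewrite inE => ees ve.
(* [altpath_inner] does not apply here, because a closed walk repeats vertices; this is its analogue
   for trails. *)
have inner s' y b m : trail y s' (b :: m) -> path (fun e g => C e != C g) b m ->
    e \in b :: m -> [\/ v = y /\ e = b, v = last y s' /\ e = last b m
    | exists g, [/\ g \in b :: m, v \in val g & C g != C e]].
  elim: s' y b m {tr ue srt Cl ees lx} => [|z s' IH] y {}a {}l //=.
  case/andP=> /eqP ayz tr srt; rewrite inE => /orP[/eqP ea|el].
    move: ve; rewrite ea (ayz : val a = _) !inE => /orP[]/eqP->; first by constructor 1.
    case: l s' tr srt {IH} => [|g l] [|t s'] //=; first by constructor 2.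
    case/andP=> /eqP gzt _ /andP[Ceg _]; constructor 3; exists g.
    split; [by rewrite !inE eqxx orbT | by rewrite (gzt : val g = _) !inE eqxx | by rewrite eq_sym].
  case: l tr srt el => [|g l] //= tr /andP[Cag srt] el.
  case: (IH z g l tr srt el) => [[vz eg]|H|[g' [g's vg' Cg']]].
  - by constructor 3; exists a; split;
      rewrite ?mem_head // ?(ayz : val a = _) ?vz ?inE ?eqxx ?orbT // eg.
  - by constructor 2.
  by constructor 3; exists g'; rewrite inE g's orbT.
have [/= xa] := trail_ends a tr isT; rewrite lx => xl.
case: (inner s x a l tr srt ees) => [[-> ->]|[-> ->]|[g [gs vg Cg]]].
- by exists (last a l); rewrite inE mem_last.
- by exists a; rewrite inE mem_head lx eq_sym.
by exists g; rewrite inE.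
Qed.

(** The head edge is the only path edge at the first vertex, so it has no partner there and cannot
    lie in [Z]; peel it off and repeat. *)
Lemma altpath_acyclic C K x s es (Z : {set edge E}) : altpath C K x s es ->
  (forall e v, e \in Z -> v \in val e -> exists g, [/\ g \in Z, v \in val g & C g != C e]) ->
  {subset Z <= es} -> Z = set0.
Proof.
move=> ap opp; elim: s x es ap => [|y s IH] x [|e es] // ap sub.
- by apply/setP=> e; rewrite inE; apply/negP=> /sub.
have [exy xs _ ap' _] := altpath_cons ap.
apply: (IH _ _ ap') => g gZ; have := sub g gZ; rewrite inE => /orP[/eqP ge|//].
rewrite ge in gZ; have [|g' [g'Z xg' Cg']] := opp e x gZ; first by rewrite exy !inE eqxx.
have := sub _ g'Z; rewrite inE => /orP[/eqP ge'|g's]; first by rewrite ge' eqxx in Cg'.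
by case/negP: xs; apply: trail_mem (altpath_trail ap') g's xg'.
Qed.

(** The path may be built in a smaller set [K], but its ends must be dead in the whole color class,
    since the walks of the chain may continue through any edge of it. *)
Lemma maximal_path C K x s es f p q : altpath C K x s es -> f \in es ->
  K \subset color_class2 C p q -> dead_ends C (color_class2 C p q) x s es ->
  [set e in es] \in maximal_alternating C setT p q f.
Proof.
move=> ap fes KS [dx dl]; rewrite inE; apply/orP; right.
have es0 : es != [::] by case: (es) fes.
have [tr us _ _] := and4P ap; have ues := trail_uniq tr us.
have we := trail_walk_edges tr.
rewrite inE; apply/and3P; split; first by rewrite inE.
  apply/forallP=> Z; apply/implyP=> Zc; apply/negP=> /subsetP sub.
  have Z0 : Z = set0.
    apply: altpath_acyclic ap _ _ => [e v|e /sub]; last by rewrite inE.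
    exact: closing_opposite Zc.
  by move: Zc; rewrite Z0 !inE.
apply: (@some_seqI _ (x :: s)).
  by rewrite /= !ltnS -(trail_size tr) uniq_edges_size.
rewrite (altpath_alternating ap es0 KS) we eqxx andbT /=.
rewrite negb_exists; apply/forallP=> y; apply/negP=> /orP[]/and4P[wk _ col srt'].
  have := walk_trail wk; move: col srt'; case: (walk_edges E _) => // e W.
  move=> /andP[/andP[_ Ke] _] srt' /andP[/eqP eyx trW].
  move: srt'; rewrite -(trail_walk_edges trW) we => srt'.
  have Ce : C e = C (head e es).
    by apply: dx; [rewrite inE | rewrite (eyx : val e = _) !inE eqxx orbT].
  by case: es es0 srt' Ce {fes ap dx dl tr us ues we trW} => //= a l _ /andP[/eqP].
have := walk_trail wk; move: col srt'.
case/lastP: (walk_edges E _) => [|W e] col srt' trW; first by case: (s) trW.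
move: trW; rewrite trail_rcons => /andP[trW /eqP ev].
move: srt' col; rewrite -(trail_walk_edges trW) we all_rcons => srt' /andP[/andP[_ Ke] _].
have Ce : C e = C (last e es).
  by apply: dl; [rewrite inE | rewrite (ev : val e = _) !inE eqxx].
case: es es0 srt' Ce {fes ap dx dl tr us ues we trW} => //= a l _.
by rewrite rcons_path => /andP[_ /negP Ce] /esym /eqP.
Qed.

End Components.

(** * Deficiencies and flips at a vertex *)

Section LocalColorings.

Context (V : finType) (E : {set {set V}}) (k : nat).

Implicit Types (u v w x y z : V) (e f g h m : edge E).
Implicit Types (C D : colormap E k) (K F : {set edge E}) (a b c d p q : 'I_k).

Definition ok_at D v :=
  forall e g, v \in val e -> v \in val g -> D e = D g -> e = g.

(* A (+p-q)-deficiency at v, with its two p-edges e and g. *)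
Record doubled D v p q e g : Prop := Doubled {
  dbl_neq : e != g;
  dbl_in1 : v \in val e;
  dbl_in2 : v \in val g;
  dbl_col1 : D e = p;
  dbl_col2 : D g = p;
  dbl_only : forall h, v \in val h -> D h = p -> h = e \/ h = g;
  dbl_missing : forall h, v \in val h -> D h <> q;
  dbl_other : forall h h', v \in val h -> v \in val h' -> D h = D h' ->
    D h <> p -> h = h' }.

Lemma doubled_sym D v p q e g : doubled D v p q e g -> doubled D v p q g e.
Proof.
case=> eg ve vg De Dg only miss other; split=> //; first by rewrite eq_sym.
by move=> h vh /(only h vh)[]; [right | left].
Qed.

Lemma doubled_missing D v p q q' e g : doubled D v p q e g ->
  (forall h, v \in val h -> D h <> q') -> doubled D v p q' e g.
Proof. by case=> *; split. Qed.

Lemma proper_coloringP D : reflect (forall v, ok_at D v) (proper_coloring D).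
Proof.
apply: (iffP forallP) => [prop v e g ve vg Deg|prop e].
  apply/eqP/idPn=> eg; have /forallP/(_ g) := prop e.
  by rewrite eg Deg eqxx /= implybF; case/set0Pn; exists v; rewrite inE ve.
apply/forallP=> g; apply/implyP=> /andP[eg /set0Pn[v]].
by rewrite inE => /andP[ve vg]; apply/eqP=> Deg; case/eqP: eg; apply: (prop v).
Qed.

Lemma ok_deficiency D v p q : ok_at D v -> deficiency D v p q = false.
Proof.
move=> ok; apply/negP=> /and3P[/cards2P[e [g [eg deg]]] _ _].
have: e \in edges_at D v p by rewrite deg !inE eqxx.
have: g \in edges_at D v p by rewrite deg !inE eqxx orbT.
rewrite !inE => /andP[vg /eqP Dg] /andP[ve /eqP De].
by case/eqP: eg; apply: ok => //; rewrite De Dg.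
Qed.

Lemma doubled_edges_at D v p q e g : doubled D v p q e g ->
  edges_at D v p = [set e; g].
Proof.
case=> eg ve vg De Dg only _ _; apply/setP=> h; rewrite !inE.
apply/andP/orP => [[vh /eqP Dh]|[]/eqP->]; rewrite ?De ?Dg ?eqxx //.
by case: (only h vh Dh) => ->; [left|right].
Qed.

Lemma doubled_deficiency D v p q e g : doubled D v p q e g -> deficiency D v p q.
Proof.
move=> H; apply/and3P; split.
- by rewrite (doubled_edges_at H) cards2 (dbl_neq H).
- apply/forallP=> c; apply/implyP=> cp; apply/card_le1P => h; rewrite !inE.
  case/andP=> vh /eqP Dh h'; rewrite !inE; apply/idP/eqP=> [/andP[vh' /eqP Dh']|->].
    by apply: (dbl_other H) => //; rewrite Dh'; [| apply/eqP].
  by rewrite vh Dh eqxx.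
apply/eqP/setP=> h; rewrite !inE; apply/negP=> /andP[vh /eqP].
exact: dbl_missing H h vh.
Qed.

Lemma doubled_deficient D v p q e g : doubled D v p q e g -> v \in deficient D.
Proof.
move=> /doubled_deficiency H; rewrite inE; apply/existsP; exists p.
by apply/existsP; exists q.
Qed.

Lemma doubled_repeated D v p q e g : doubled D v p q e g -> e \in repeated_at D v.
Proof.
case=> eg ve vg De Dg _ _ _; rewrite inE ve; apply/existsP; exists g.
by rewrite eq_sym eg vg De Dg eqxx.
Qed.

Lemma ok_ext D D' v : (forall e, v \in val e -> D' e = D e) ->
  ok_at D v -> ok_at D' v.
Proof. by move=> ext ok e g ve vg; rewrite !ext //; apply: ok. Qed.

Lemma doubled_ext D D' v p q e g : (forall h, v \in val h -> D' h = D h) ->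
  doubled D v p q e g -> doubled D' v p q e g.
Proof.
move=> ext [eg ve vg De Dg only miss other]; split=> //; rewrite ?ext //.
- by move=> h vh; rewrite ext //; apply: only.
- by move=> h vh; rewrite ext //; apply: miss.
by move=> h h' vh vh'; rewrite !ext //; apply: other.
Qed.

Lemma flipE D p q F e : flip D p q F e = if e \in F then tperm p q (D e) else D e.
Proof. by rewrite ffunE. Qed.

Lemma flipC D p q F : flip D p q F = flip D q p F.
Proof. by apply/ffunP=> e; rewrite !flipE tpermC. Qed.

Lemma flipK D p q F : flip (flip D p q F) p q F = D.
Proof. by apply/ffunP=> e; rewrite !flipE; case: (e \in F) => //; rewrite tpermK. Qed.

Lemma flip_class2 D p q F :
  color_class2 (flip D p q F) p q = color_class2 D p q.
Proof.
apply/setP=> e; rewrite !inE flipE; case: ifP => // _.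
by case: tpermP => [->|->|/eqP/negbTE-> /eqP/negbTE->]; rewrite ?eqxx ?orbT.
Qed.

Lemma color_class2C D p q : color_class2 D p q = color_class2 D q p.
Proof. by apply/setP=> e; rewrite !inE orbC. Qed.

Lemma flip_away D p q F v e : (forall g, g \in F -> v \notin val g) ->
  v \in val e -> flip D p q F e = D e.
Proof. by move=> away ve; rewrite flipE; case: ifP => // /away; rewrite ve. Qed.

Lemma class2P D p q e : reflect (D e = p \/ D e = q) (e \in color_class2 D p q).
Proof. by rewrite !inE; apply: (iffP orP) => -[/eqP|/eqP]; auto => ->; auto. Qed.

(** A new conflict at [v] would pair a flipped edge with an unflipped one that had the opposite
    color, and closure puts that one into [F] too. *)
Lemma flip_ok D p q F v : F \subset color_class2 D p q ->
  closed_at D (color_class2 D p q) F v -> ok_at D v -> ok_at (flip D p q F) v.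
Proof.
move=> /subsetP FK cl ok e g ve vg.
have key e1 e2 : e1 \in F -> e2 \notin F -> v \in val e1 -> v \in val e2 ->
    tperm p q (D e1) <> D e2.
  move=> e1F e2F ve1 ve2 D12; case/negP: (e2F); apply: (cl e1) => //.
    have /class2P[] := FK _ e1F; move: D12 => /[swap] ->;
    by rewrite ?tpermL ?tpermR => D12; apply/class2P; auto.
  apply: contraNneq e2F => D21; rewrite (ok e2 e1) //.
rewrite !flipE; case: ifPn => eF; case: ifPn => gF.
- by move/perm_inj; apply: ok.
- by move/key; case.
- by move/esym/key; case.
exact: ok.
Qed.

(** Only [e] changes color at [v], and it takes the color [q] missing there. *)
Lemma flip_doubled D v p q e g F : doubled D v p q e g -> p != q -> e \in F ->
  (forall h, h \in F -> v \in val h -> h = e) -> ok_at (flip D p q F) v.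
Proof.
move=> [eg ve vg De Dg only miss other] pq eF Fe.
have inF h : v \in val h -> (h \in F) = (h == e).
  by move=> vh; apply/idP/eqP=> [/Fe-> //|->].
move=> h h' vh vh'; rewrite !flipE !inF //.
case: (h =P e) => [->|he]; case: (h' =P e) => [-> //|he'].
- by rewrite De tpermL => Dh'; case: (miss _ vh').
- by rewrite De tpermL => Dh'; case: (miss _ vh).
move=> Dhh'; case: (D h =P p) => [Dhp|]; last exact: other.
by case: (only h) => // ->; case: (only h') => //; rewrite -Dhh'.
Qed.

(** A conflict can only come from the single old [q]-edge at [v]. As [e] was the only [p]-edge, [p]
    is now missing, which gives a (+q-p)-deficiency. *)
Lemma recolor_ok D v p q e : ok_at D v -> v \in val e -> D e = p -> p != q ->
  ok_at (flip D p q [set e]) v \/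
  exists g, doubled (flip D p q [set e]) v q p e g.
Proof.
move=> ok ve De pq; have H h : flip D p q [set e] h = if h == e then q else D h.
  by rewrite flipE inE; case: eqP => // ->; rewrite De tpermL.
case: (pickP (fun g => (v \in val g) && (D g == q))) => [g /andP[vg /eqP Dg]|noq].
  have eg : e != g by apply: contraNneq pq => eg; rewrite -De eg Dg.
  right; exists g; split; rewrite ?H ?eqxx //.
  - by rewrite eq_sym (negbTE eg).
  - move=> h vh; rewrite H; case: (h =P e) => [|_ Dh]; first by left.
    by right; apply: ok; rewrite ?Dh.
  - move=> h vh; rewrite H; case: (h =P e) => [_ /eqP|he Dh].
      by rewrite eq_sym (negbTE pq).
    by case: he; apply: ok; rewrite ?Dh.
  move=> h h' vh vh'; rewrite !H.
  by case: (h =P e) => // he; case: (h' =P e) => [_ ->|he'] // Dhh' _; apply: ok.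
left=> h h' vh vh'; rewrite !H; case: (h =P e) => [->|he]; case: (h' =P e) => [->|he'] //.
- by move=> /esym/eqP Dh; have := noq h'; rewrite vh' Dh.
- by move=> /eqP Dh; have := noq h; rewrite vh Dh.
exact: ok.
Qed.

(** At [w] the flip just exchanges the colors of [e] and [m]: the deficiency stays (+b-a), but [m]
    becomes one of its two [b]-edges. *)
Lemma flip_doubled3 D w a b d e g m F : doubled D w b a e g ->
  w \in val m -> D m = d -> b != d -> a != d ->
  e \in F -> m \in F -> (forall h, h \in F -> w \in val h -> h = e \/ h = m) ->
  doubled (flip D b d F) w b a m g.
Proof.
move=> [eg we wg De Dg only miss other] wm Dm bd ad eF mF Fem.
have em : e != m by apply: contraNneq bd => em; rewrite -De em Dm.
have gm : g != m by apply: contraNneq bd => gm; rewrite -Dg gm Dm.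
have ab : a != b by apply/eqP=> ab; apply: (miss e) => //; rewrite De.
have H h : w \in val h ->
    flip D b d F h = if h == e then d else if h == m then b else D h.
  move=> wh; rewrite flipE; case: (h =P e) => [->|he]; first by rewrite eF De tpermL.
  case: (h =P m) => [->|hm]; first by rewrite mF Dm tpermR.
  by case: ifP => // hF; case: (Fem h hF wh).
split; rewrite ?H //.
- by rewrite eq_sym.
- by rewrite eq_sym (negbTE em) eqxx.
- by rewrite eq_sym (negbTE eg) (negbTE gm).
- move=> h wh; rewrite H //; case: (h =P e) => [_ /eqP|he].
    by rewrite eq_sym (negbTE bd).
  case: (h =P m) => [|hm Dh]; first by left.
  by case: (only h wh Dh) => // ->; right.
- move=> h wh; rewrite H //; case: (h =P e) => [_ /eqP|he].
    by rewrite eq_sym (negbTE ad).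
  case: (h =P m) => [_ /eqP|hm]; last exact: miss.
  by rewrite eq_sym (negbTE ab).
move=> h h' wh wh'; rewrite !H //.
have key h1 : w \in val h1 -> h1 <> e -> h1 <> m -> D h1 <> d.
  by move=> wh1 h1e h1m Dh1; apply: h1m; apply: other; rewrite ?Dh1 //; apply/eqP;
    rewrite eq_sym.
case: (h =P e) => [->|he]; case: (h' =P e) => [-> //|he'].
- by case: (h' =P m) => [_ -> //|h'm Dh' _]; case: (key h').
- by case: (h =P m) => [_ _ //|hm Dh _]; case: (key h).
case: (h =P m) => [_ _ //|hm]; case: (h' =P m) => [_ -> //|hm'].
exact: other.
Qed.

End LocalColorings.

(** * Eliminating deficiencies *)

Section Elimination.

Context (V : finType) (E : {set {set V}}) (k : nat) (side : V -> bool).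
Context (edge_ends : forall e : edge E, exists x y, val e = [set x; y]).
Context (side_edge :
  forall (e : edge E) x y, val e = [set x; y] -> side x != side y).

Implicit Types (u v w x y z : V) (e f g h m : edge E).
Implicit Types (C D : colormap E k) (K F H : {set edge E}) (a b c d p q : 'I_k).
Implicit Types (T U : {set V}) (S : {set 'I_k}).

(** All deficiencies use the same two colors, with either sign; [T] is the set of deficient
    vertices. *)
Definition almost D a b T :=
  (forall v, v \notin T -> ok_at D v) /\
  (forall v, v \in T -> exists e g, doubled D v a b e g \/ doubled D v b a e g).

Lemma almostP D a b T v : almost D a b T -> v \in T -> exists p q e g,
  [/\ doubled D v p q e g, color_class2 D a b = color_class2 D p q,
      [set p; q] = [set a; b]
    & forall F, flip D a b F = flip D p q F].
Proof.
move=> [_ al] /al[e [g [dbl|dbl]]]; first by exists a, b, e, g.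
exists b, a, e, g; split=> //; [exact: color_class2C | exact: setUC | move=> F;
  exact: flipC].
Qed.

Lemma class2_two_colored D K p q : K \subset color_class2 D p q -> two_colored D K.
Proof.
move=> /subsetP KS e g h /KS/class2P He /KS/class2P Hg /KS/class2P Hh.
by case: He Hg Hh => -> [] -> [] ->; rewrite ?eqxx.
Qed.

Lemma doubled_class2 D v p q e g h : doubled D v p q e g ->
  h \in color_class2 D p q -> v \in val h -> D h = p.
Proof. by move=> dbl /class2P[] // Dh /(dbl_missing dbl). Qed.

(** At a deficient vertex the edges of the class all have one color, so no alternation passes
    through it. *)
Lemma almost_forced D a b T : almost D a b T -> forced D (color_class2 D a b).
Proof.
move=> al v e g h eK gK hK ve vg vh.
have [vT|/al.1 ok] := boolP (v \in T); last first.
  move=> Ce Cg; apply: ok => //.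
  exact: (class2_two_colored (subxx _) eK gK hK).
have [p [q [e' [g' [dbl clE _ _]]]]] := almostP al vT; rewrite clE in eK gK hK.
by rewrite (doubled_class2 dbl gK vg) (doubled_class2 dbl eK ve) eqxx.
Qed.

Lemma end_vertices_other H v g1 g2 : g1 \in H -> g2 \in H -> g1 != g2 ->
  v \in val g1 -> v \in val g2 -> v \notin end_vertices H.
Proof.
move=> g1H g2H g12 v1 v2; rewrite inE; apply/cards1P=> -[g /setP dg].
have := dg g2; have := dg g1; rewrite !inE g1H g2H v1 v2 /=.
by move=> /esym/eqP <- /esym/eqP g21; rewrite g21 eqxx in g12.
Qed.

(** The component of [e] is not a cycle, because [q] is missing at [w]. It is therefore a path, and
    any deficient vertex on it is one of its ends; so the flip repairs [w] together with [t], if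
    deficient, and touches no other deficient vertex. *)
Lemma eliminate_path D a b T w p q e g : a != b -> almost D a b T ->
  doubled D w p q e g -> color_class2 D a b = color_class2 D p q ->
  let H := color_class2 D a b in
  exists F t, [/\ F \in maximal_alternating D setT p q e, F \in subpaths H,
    end_vertices F = [set w; t] /\ t != w, t \in T \/ t \in end_vertices H
    & almost (flip D a b F) a b (T :\: [set w; t])].
Proof.
move=> ab al dbl clE H; have [eg we wg De Dg _ _ _] := dbl.
have tc : two_colored D H by apply: (class2_two_colored (subxx _)).
have fo : forced D H := almost_forced al.
have eH : e \in H by rewrite /H clE; apply/class2P; left.
have noopp v p' q' e1 g1 h h' : doubled D v p' q' e1 g1 ->
    color_class2 D a b = color_class2 D p' q' -> h \in H -> h' \in H ->
    v \in val h -> v \in val h' -> D h = D h'.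
  move=> dbl' clE'; rewrite /H clE' => hH h'H vh vh'.
  by rewrite (doubled_class2 dbl' hH vh) (doubled_class2 dbl' h'H vh').
have [x [s [es [ap ees [[h cl]|dead]]]]] := altpath_component edge_ends side_edge tc fo eH.
  have [|h' [h's wh' /eqP[]]] := cycle_opposite ap cl (_ : e \in h :: es) we.
    by rewrite inE ees orbT.
  apply: noopp dbl clE _ _ wh' we => //; move: h's; rewrite inE => /orP[/eqP->|].
    by case: cl.
  exact: altpath_in ap.
have es0 : es != [::] by case: (es) ees.
have FH : [set f in es] \subset H.
  by apply/subsetP=> f; rewrite inE; apply: altpath_in ap.
have endsF := altpath_ends ap es0.
have xl : x != last x s.
  case/and4P: (ap) => tr /andP[xs _] _ _; apply: contraNneq xs => xl.
  case: (s) tr xl => [|y s'] tr xl; last by rewrite xl /= mem_last.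
  by case/negP: es0; rewrite -size_eq0 (trail_size tr).
have endT v f p' q' e1 g1 : doubled D v p' q' e1 g1 ->
    color_class2 D a b = color_class2 D p' q' -> f \in es -> v \in val f ->
    v \in [set x; last x s].
  move=> dbl' clE' fs vf; rewrite !inE.
  case: (altpath_inner ap fs vf) => [[-> _]|[-> _]|[h [hs vh /eqP[]]]];
    rewrite ?eqxx ?orbT //.
  by apply: noopp dbl' clE' _ _ vh vf; apply: altpath_in ap _.
have [t [tw wt]] : exists t, t != w /\ [set x; last x s] = [set w; t].
  have := endT _ _ _ _ _ _ dbl clE ees we; rewrite !inE => /orP[]/eqP->.
    by exists (last x s); rewrite eq_sym.
  by exists x; rewrite setUC.
exists [set f in es], t; split.
- by apply: (@maximal_path _ _ _ D H x s) => //; rewrite -clE.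
- exact: (@subpath_altpath _ _ _ D H _ x s).
- by rewrite endsF wt.
(* If [t] is not deficient, another edge of the class at [t] would have the other color and so lie
   on the path, although [t] is an end of it. *)
- have [tT|/al.1 okt] := boolP (t \in T); [by left | right].
  have: t \in end_vertices [set f in es] by rewrite endsF wt !inE eqxx orbT.
  rewrite inE => /cards1P[f /setP df]; have := df f; rewrite !inE eqxx => /andP[fs tf].
  apply/cards1P; exists f; apply/setP=> h; rewrite !inE.
  apply/idP/eqP => [/andP[hH th]|->]; last first.
    by rewrite tf andbT; have := subsetP FH f; rewrite !inE => ->.
  have [/okt->//|/eqP Dhf] := eqVneq (D h) (D f).
  suff hs : h \in es by have := df h; rewrite !inE hs th => /esym/eqP.
  have := @closed_path _ _ _ D H x s es t fo ap dead f h; rewrite !inE; apply=> //;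
    last exact/eqP.
have away v : v \notin [set w;
  t] -> v \in T -> forall f, f \in [set f in es] -> v \notin val f.
  move=> vwt vT f; rewrite inE => fs; apply: contra vwt => vf.
  have [p' [q' [e1 [g1 [dbl' clE' _ _]]]]] := almostP al vT.
  by rewrite -wt; apply: endT dbl' clE' fs vf.
split=> v; rewrite inE ?negb_and.
  rewrite negbK; have [vT|/al.1 ok _] := boolP (v \in T); last first.
    by apply: flip_ok => //; apply: closed_path ap dead.
  rewrite orbF => vwt; have [p' [q' [e1 [g1 [dbl' clE' _ ->]]]]] := almostP al vT.
  have pq' : p' != q'.
    by apply/eqP=> pq'; apply: (dbl_missing dbl' (dbl_in1 dbl')); rewrite (dbl_col1 dbl').
  have: v \in end_vertices [set f in es] by rewrite endsF wt.
  rewrite inE => /cards1P[f /setP df]; have := df f; rewrite !inE eqxx => /andP[fs vf].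
  have Df : D f = p'.
    by apply: doubled_class2 dbl' _ vf; rewrite -clE'; apply: altpath_in ap fs.
  have key e2 g2 : doubled D v p' q' e2 g2 -> f = e2 -> ok_at (flip D p' q' [set f0 in es]) v.
    move=> dbl2 fe; apply: (flip_doubled dbl2) => //; first by rewrite -fe inE.
    by move=> h; rewrite inE => hs vh; have := df h; rewrite !inE hs vh -fe => /esym/eqP.
  case: (dbl_only dbl' vf Df); first exact: key dbl'.
  exact: key (doubled_sym dbl').
case/andP=> vwt vT; have [e1 [g1 H1]] := al.2 v vT; exists e1, g1.
have ext h : v \in val h -> flip D a b [set f in es] h = D h.
  by apply: flip_away; apply: away.
by case: H1 => H1; [left|right]; apply: doubled_ext H1.
Qed.

End Elimination.

(** * Transitions of positive probability *)

Section ChainMoves.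

Context (V : finType) (E : {set {set V}}) (k : nat).

Implicit Types (u v w x y z : V) (e f g h m : edge E).
Implicit Types (C D : colormap E k) (K F H : {set edge E}) (a b c d p q : 'I_k).
Implicit Types (T U : {set V}) (S : {set 'I_k}).

Definition phase2 C a b : dist (colormap E k) :=
  let H := color_class2 C a b in
  third (ret C) (flip_choice C a b (subpaths H :|: subcycles H)) (flip_pair C a b).

Definition phase3 C a b : dist (colormap E k) :=
  let H := color_class2 C a b in
  third (ret C)
    (flip_choice C a b
      [set F in subpaths H | ~~ (end_vertices F \subset end_vertices H)])
    (flip_pair C a b).

Lemma flip_choice_nneg C a b A : nneg (flip_choice C a b A).
Proof. by apply: draw_nneg => [|F]; apply: ret_nneg. Qed.

Lemma flip_pair_nneg C a b : nneg (flip_pair C a b).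
Proof. by apply: draw_nneg => [|q]; apply: ret_nneg. Qed.

Lemma phase2_nneg C a b : nneg (phase2 C a b).
Proof.
by apply: third_nneg; [apply: ret_nneg|apply: flip_choice_nneg|apply: flip_pair_nneg].
Qed.

Lemma phase3_nneg C a b : nneg (phase3 C a b).
Proof.
by apply: third_nneg; [apply: ret_nneg|apply: flip_choice_nneg|apply: flip_pair_nneg].
Qed.

Lemma flip_maximal_nneg C (A : {set edge E}) a b f : nneg (flip_maximal C A a b f).
Proof. by apply: draw_nneg => [|F]; apply: ret_nneg. Qed.

Lemma recolor2_nneg a b C : nneg (recolor2 a b C).
Proof.
rewrite /recolor2; case: ifP => _; last first.
  by apply: coin_nneg; [apply: draw_nneg => *|]; apply: ret_nneg.
apply: draw_nneg => [|v]; first exact: ret_nneg.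
by apply: draw_nneg => [|f]; apply: ret_nneg.
Qed.

Lemma flip_at_deficient_nneg d C : nneg (flip_at_deficient d C).
Proof.
apply: draw_nneg => [|v]; first exact: ret_nneg.
by apply: draw_nneg => [|f]; [apply: ret_nneg|apply: flip_maximal_nneg].
Qed.

Lemma flip_at_nondeficient_nneg a b d C : nneg (flip_at_nondeficient a b d C).
Proof.
apply: draw_nneg => [|v]; first exact: ret_nneg.
apply: draw_nneg => [|e]; first exact: ret_nneg.
by apply: draw_nneg => [|f]; [apply: ret_nneg|apply: flip_maximal_nneg].
Qed.

Lemma recolor3_nneg a b d C : nneg (recolor3 a b d C).
Proof.
rewrite /recolor3; case: #|_| => [|[|n]].
- exact: flip_at_nondeficient_nneg.
- by apply: coin_nneg; [apply: flip_at_deficient_nneg|apply: flip_at_nondeficient_nneg].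
exact: flip_at_deficient_nneg.
Qed.

Lemma eliminate1_nneg S C : nneg (eliminate1 S C).
Proof.
apply: draw_nneg => [|[[v a] b]]; first exact: ret_nneg.
by apply: draw_nneg => [|f]; [apply: ret_nneg|apply: flip_maximal_nneg].
Qed.

Definition eliminate_rounds n S C : dist (colormap E k) :=
  iter n (fun mu => bind mu (eliminate1 S)) (ret C).

Lemma eliminate_rounds_nneg n S C : nneg (eliminate_rounds n S C).
Proof.
elim: n => [|n IH]; first exact: ret_nneg.
by apply: bind_nneg => //; apply: eliminate1_nneg.
Qed.

Local Open Scope ring_scope.

Lemma eliminate_rounds_step n S C D D' : 0 < eliminate_rounds n S C D ->
  0 < eliminate1 S D D' -> 0 < eliminate_rounds n.+1 S C D'.
Proof.
apply: bind_pos; first exact: eliminate_rounds_nneg.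
exact: eliminate1_nneg.
Qed.

Lemma eliminate1_proper S C : proper_coloring C -> 0 < eliminate1 S C C.
Proof.
move=> /proper_coloringP ok; rewrite /eliminate1 /draw.
set A := [set t | _]; suff -> : A == set0 by apply: ret_pos.
by apply/eqP/setP=> -[[v a] b]; rewrite !inE /= ok_deficiency ?andbF.
Qed.

(** The chain always runs [#|V|] rounds; those left over once the coloring is proper change
    nothing. *)
Lemma eliminate_proper n S C D : proper_coloring D ->
  (n <= #|V|)%N -> 0 < eliminate_rounds n S C D -> 0 < eliminate S C D.
Proof.
move=> Dp /subnK; rewrite -[eliminate S C]/(eliminate_rounds #|V| S C) => <- H.
elim: (#|V| - n)%N => // i IH.
by apply: eliminate_rounds_step IH _; apply: eliminate1_proper.
Qed.

Lemma eliminate1_pos S D v p q e g F : p \in S -> q \in S ->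
  doubled D v p q e g -> F \in maximal_alternating D setT p q e ->
  0 < eliminate1 S D (flip D p q F).
Proof.
move=> pS qS dbl Fmax; apply: (@draw_pos _ _ _ _ _ (v, p, q)).
- move=> [[v' a'] b']; apply: draw_nneg => [|f];
    [exact: ret_nneg|exact: flip_maximal_nneg].
- by rewrite inE /= pS qS (doubled_deficiency dbl).
apply: (@draw_pos _ _ _ _ _ e).
- by move=> f; apply: flip_maximal_nneg.
- by rewrite (doubled_edges_at dbl) !inE eqxx.
apply: draw_pos Fmax _ => [F'|]; [exact: ret_nneg | exact: ret_pos].
Qed.

Lemma chain_step_pos C C' :
  (exists a b, a != b /\ 0 < two_color_move C a b C') \/
  (exists a b d, uniq [:: a; b; d] /\ 0 < three_color_move C a b d C') ->
  0 < chain_step C C'.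
Proof.
have n2 a b : nneg (two_color_move C a b).
  apply: bind_nneg => [|D]; last exact: eliminate_rounds_nneg.
  by apply: bind_nneg => [|D]; [apply: phase2_nneg | apply: recolor2_nneg].
have n3 a b d : nneg (three_color_move C a b d).
  apply: bind_nneg => [|D]; last exact: eliminate_rounds_nneg.
  by apply: bind_nneg => [|D]; [apply: phase3_nneg | apply: recolor3_nneg].
move=> H; apply: lazy_mix_pos; first exact: ret_nneg.
- by apply: draw_nneg => [|q]; [apply: ret_nneg | apply: n2].
- by apply: draw_nneg => [|q]; [apply: ret_nneg | apply: n3].
case: H => [[a [b [ab pos]]]|[a [b [d [abd pos]]]]]; [left|right].
  by apply: (@draw_pos _ _ _ _ _ (a, b)); rewrite ?inE.
by apply: (@draw_pos _ _ _ _ _ (a, b, d)) => //; rewrite inE.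
Qed.

Lemma chain_step2 C D D' C' a b : a != b -> 0 < phase2 C a b D ->
  0 < recolor2 a b D D' -> 0 < eliminate [set a; b] D' C' -> 0 < chain_step C C'.
Proof.
move=> ab CD DD D'C; apply: chain_step_pos; left; exists a, b; split=> //.
apply: bind_pos D'C => [|D1|].
- by apply: bind_nneg => [|D1]; [apply: phase2_nneg | apply: recolor2_nneg].
- exact: eliminate_rounds_nneg.
by apply: bind_pos DD => // [|D1]; [apply: phase2_nneg | apply: recolor2_nneg].
Qed.

Lemma chain_step3 C D D' C' a b d : uniq [:: a; b; d] -> 0 < phase3 C a b D ->
  0 < recolor3 a b d D D' -> 0 < eliminate [set a; b; d] D' C' ->
  0 < chain_step C C'.
Proof.
move=> abd CD DD D'C; apply: chain_step_pos; right; exists a, b, d; split=> //.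
apply: bind_pos D'C => [|D1|].
- by apply: bind_nneg => [|D1]; [apply: phase3_nneg | apply: recolor3_nneg].
- exact: eliminate_rounds_nneg.
by apply: bind_pos DD => // [|D1]; [apply: phase3_nneg | apply: recolor3_nneg].
Qed.

Lemma recolor2_deficient D v p q e g a b : doubled D v p q e g ->
  0 < recolor2 a b D (flip D a b [set e]).
Proof.
move=> dbl; have vd := doubled_deficient dbl; rewrite /recolor2.
have -> : deficient D != set0 by apply/set0Pn; exists v.
apply: draw_pos vd _ => [v'|].
  by apply: draw_nneg => [|f]; apply: ret_nneg.
apply: draw_pos (doubled_repeated dbl) _ => [f|]; first exact: ret_nneg.
exact: ret_pos.
Qed.

Lemma proper_deficient D : proper_coloring D -> deficient D = set0.
Proof.
move/proper_coloringP=> ok; apply/setP=> v; rewrite !inE.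
by apply/existsP=> -[p /existsP[q]]; rewrite ok_deficiency.
Qed.

Lemma recolor2_proper D a b : proper_coloring D -> 0 < recolor2 a b D D.
Proof.
move=> Dp; rewrite /recolor2 proper_deficient // eqxx /=.
apply: coin_posr; last exact: ret_pos.
by apply: draw_nneg => [|f]; apply: ret_nneg.
Qed.

Lemma recolor2_proper_edge D a b e : proper_coloring D ->
  e \in color_class2 D a b -> 0 < recolor2 a b D (flip D a b [set e]).
Proof.
move=> Dp eH; rewrite /recolor2 proper_deficient // eqxx /=.
apply: coin_posl; first exact: ret_nneg.
by apply: draw_pos eH _ => [f|]; [apply: ret_nneg | apply: ret_pos].
Qed.

Lemma recolor3_deficient D v p q e g F a b d : doubled D v p q e g ->
  F \in maximal_alternating D setT p d e ->
  0 < recolor3 a b d D (flip D p d F).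
Proof.
move=> dbl Fmax; have vd := doubled_deficient dbl.
have pos : 0 < flip_at_deficient d D (flip D p d F).
  apply: draw_pos vd _ => [v'|].
    by apply: draw_nneg => [|f]; [apply: ret_nneg | apply: flip_maximal_nneg].
  apply: draw_pos (doubled_repeated dbl) _ => [f|]; first exact: flip_maximal_nneg.
  rewrite (dbl_col1 dbl); apply: draw_pos Fmax _ => [F'|]; first exact: ret_nneg.
  exact: ret_pos.
rewrite /recolor3; case def_n: #|_| => [|[|n]] //.
  by move/eqP: def_n; rewrite cards_eq0 => /eqP d0; rewrite d0 inE in vd.
by apply: coin_posl => //; apply: flip_at_nondeficient_nneg.
Qed.

End ChainMoves.

(** * Proper colorings that shadow an almost coloring *)

Section Settling.

Context (V : finType) (E : {set {set V}}) (k : nat) (side : V -> bool).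
Context (edge_ends : forall e : edge E, exists x y, val e = [set x; y]).
Context (side_edge :
  forall (e : edge E) x y, val e = [set x; y] -> side x != side y).

Implicit Types (u v w x y z : V) (e f g h m : edge E).
Implicit Types (C D : colormap E k) (K F H : {set edge E}) (a b c d p q : 'I_k).
Implicit Types (T U : {set V}) (S : {set 'I_k}).

Local Open Scope ring_scope.

(* D can be drawn from C by the sub-path flips that open a move of either kind. *)
Definition reach C D a b := 0 < phase2 C a b D /\ 0 < phase3 C a b D.

Lemma reach_refl C a b : reach C C a b.
Proof.
by split; apply: third_pos; first [exact: ret_nneg | exact: flip_choice_nneg
  | exact: flip_pair_nneg | constructor 1; exact: ret_pos].
Qed.

Lemma phase2_path C D a b F : F \in subpaths (color_class2 C a b) ->
  D = flip C a b F -> 0 < phase2 C a b D.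
Proof.
move=> Fs ->; apply: third_pos;
  [exact: ret_nneg | exact: flip_choice_nneg | exact: flip_pair_nneg |].
constructor 2; apply: (@draw_pos _ _ _ _ _ F) => [F'||]; first exact: ret_nneg.
  by rewrite inE Fs.
exact: ret_pos.
Qed.

(** The end [w], which is not an end of the color class, is what the opening of a three-color move
    demands of a single sub-path. *)
Lemma reach_path C D a b F w : F \in subpaths (color_class2 C a b) ->
  w \in end_vertices F -> w \notin end_vertices (color_class2 C a b) ->
  D = flip C a b F -> reach C D a b.
Proof.
move=> Fs wF wH DC; split; first exact: phase2_path Fs DC.
rewrite DC; apply: third_pos; [exact: ret_nneg | exact: flip_choice_nneg | exact: flip_pair_nneg |].
constructor 2; apply: (@draw_pos _ _ _ _ _ F) => [F'||]; first exact: ret_nneg.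
  by rewrite inE Fs; apply: contra wH => /subsetP; apply.
exact: ret_pos.
Qed.

Lemma reach_pair C D a b F1 F2 : F1 != F2 ->
  F1 \in hanging_subpaths (color_class2 C a b) ->
  F2 \in hanging_subpaths (color_class2 C a b) ->
  D = flip (flip C a b F1) a b F2 -> reach C D a b.
Proof.
move=> F12 F1h F2h ->.
have pos : 0 < flip_pair C a b (flip (flip C a b F1) a b F2).
  apply: (@draw_pos _ _ _ _ _ (F1, F2)) => [F'||]; first exact: ret_nneg.
    by rewrite inE /= F1h F2h.
  exact: ret_pos.
by split; apply: third_pos; first [exact: ret_nneg | exact: flip_choice_nneg
  | exact: flip_pair_nneg | constructor 3].
Qed.

Lemma hanging_ends F H w t : F \in subpaths H -> end_vertices F = [set w; t] ->
  w \notin end_vertices H -> t \in end_vertices H -> F \in hanging_subpaths H.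
Proof.
move=> Fs Fe wH tH; rewrite inE Fs Fe; apply/cards1P; exists t.
apply/setP=> v; rewrite in_setI in_set2 in_set1.
apply/andP/eqP=> [[/orP[]/eqP-> //]|->]; first by rewrite (negbTE wH).
by rewrite eqxx orbT.
Qed.

(* One elimination ends in an end of H or in the other deficient vertex; undoing
   the one or two flips is a legal choice of sub-paths in C. *)
Lemma settle D a b T : a != b -> almost D a b T -> (#|T| <= 2)%N ->
  exists C, [/\ proper_coloring C, reach C D a b
    & forall S, a \in S -> b \in S -> 0 < eliminate S D C].
Proof.
move=> ab al T2.
have proper0 D1 T1 : almost D1 a b T1 -> T1 = set0 -> proper_coloring D1.
  by move=> [ok _] T10; apply/proper_coloringP=> v; apply: ok; rewrite T10 inE.
have [T0|/set0Pn[w wT]] := eqVneq T set0.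
  exists D; have Dp := proper0 _ _ al T0; split=> //; first exact: reach_refl.
  by move=> S _ _; apply: (@eliminate_proper _ _ _ 0) => //; apply: ret_pos.
have [p [q [e [g [dbl clE pq flE]]]]] := almostP al wT.
have [F [t [Fmax Fs [Fe tw] tTH al1]]] := eliminate_path edge_ends side_edge ab al dbl clE.
(* Two rounds of elimination may be needed, and the chain performs [#|V|] of them. *)
have V2 : (2 <= #|V|)%N.
  have [x [y exy]] := edge_ends e; have := side_edge exy.
  case: (x =P y) => [->|/eqP xy _]; first by rewrite eqxx.
  by have := max_card (mem [set x; y]); rewrite cards2 xy.
have pS S : a \in S -> b \in S -> p \in S /\ q \in S.
  move=> aS bS; have /subsetP pqS : [set p; q] \subset S.
    by rewrite pq; apply/subsetP=> c; rewrite !inE => /orP[]/eqP->.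
  by rewrite !pqS // !inE eqxx ?orbT.
have step1 S : a \in S -> b \in S -> 0 < eliminate1 S D (flip D a b F).
  by move=> aS bS; have [pS' qS'] := pS S aS bS; rewrite flE;
    apply: eliminate1_pos dbl Fmax.
(* Flipping permutes the two colors within the class, so all colorings involved share the same class
   and the same end vertices. *)
have HH : color_class2 (flip D a b F) a b = color_class2 D a b by apply: flip_class2.
have wH : w \notin end_vertices (color_class2 D a b).
  rewrite clE; apply: (@end_vertices_other _ _ _ w e g); case: dbl => // *;
    exact/class2P/or_introl.
set D1 := flip D a b F in al1 step1 HH.
have wF : w \in end_vertices F by rewrite Fe !inE eqxx.
have done1 : T :\: [set w; t] = set0 -> exists C, [/\ proper_coloring C, reach C D a b
    & forall S, a \in S -> b \in S -> 0 < eliminate S D C].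
  move=> T0; exists D1; have D1p := proper0 _ _ al1 T0; split=> //.
    by apply: (@reach_path _ _ _ _ F w); rewrite ?HH // flipK.
  move=> S aS bS; apply: (@eliminate_proper _ _ _ 1) => //; first exact: ltnW.
  by apply: eliminate_rounds_step (step1 S aS bS); apply: ret_pos.
have [tT|tT] := boolP (t \in T).
  apply: done1; apply/eqP; rewrite -cards_eq0 cardsD (setIidPr _).
    by rewrite cards2 (eq_sym w) tw subn_eq0.
  by apply/subsetP=> v; rewrite !inE => /orP[]/eqP->.
have [T0|/set0Pn[u uT1]] := eqVneq (T :\: [set w; t]) set0; first exact: done1.
have tH : t \in end_vertices (color_class2 D a b) by case: tTH => // tT';
  rewrite tT' in tT.
have Tu : T :\: [set w; t] = [set u].
  have Tw : T :\: [set w; t] \subset T :\ w.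
    by apply/subsetP=> v; rewrite !inE negb_or => /andP[/andP[-> _] ->].
  apply/esym/eqP; rewrite eqEcard sub1set uT1 cards1 /=.
  by apply: leq_trans (subset_leq_card Tw) _; move: T2; rewrite (cardsD1 w T) wT.
have [p' [q' [e' [g' [dbl' clE' pq' flE']]]]] := almostP al1 uT1.
have [F' [t' [Fmax' Fs' [Fe' tu'] tTH' al2]]] :=
  eliminate_path edge_ends side_edge ab al1 dbl' clE'.
set D2 := flip D1 a b F' in al2.
have D2p : proper_coloring D2.
  by apply: proper0 al2 _; rewrite Tu; apply/eqP; rewrite setD_eq0 sub1set !inE eqxx.
have HH2 : color_class2 D2 a b = color_class2 D a b by rewrite flip_class2.
have uH : u \notin end_vertices (color_class2 D a b).
  rewrite -HH clE'; apply: (@end_vertices_other _ _ _ u e' g'); case: dbl' => // *;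
    exact/class2P/or_introl.
have tH' : t' \in end_vertices (color_class2 D a b).
  by rewrite -HH; case: tTH' => //; rewrite Tu inE (negbTE tu').
exists D2; split=> //.
  (* Undo the second elimination and then the first. The two paths differ: [w] is an end of [F]
     only, since the ends of [F'] are [u] and an end vertex of the class. *)
  apply: (@reach_pair _ _ _ _ F' F); rewrite ?HH2.
  - apply/eqP=> FF; have: w \in end_vertices F' by rewrite FF.
    rewrite Fe' !inE => /orP[]/eqP wE.
      by move: uT1; rewrite -wE !inE eqxx.
    by rewrite wE tH' in wH.
  - by apply: hanging_ends Fe' uH tH'; rewrite -HH.
  - exact: hanging_ends Fe wH tH.
  by rewrite /D2 flipK /D1 flipK.
move=> S aS bS; apply: (@eliminate_proper _ _ _ 2) => //.
apply: eliminate_rounds_step (_ : 0 < eliminate1 S D1 D2).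
  by apply: eliminate_rounds_step (step1 S aS bS); apply: ret_pos.
have /subsetP pqS : [set p'; q'] \subset S.
  by rewrite pq'; apply/subsetP=> c; rewrite !inE => /orP[]/eqP->.
by rewrite /D2 flE'; apply: eliminate1_pos dbl' Fmax'; apply: pqS;
  rewrite !inE eqxx ?orbT.
Qed.

End Settling.

(** * The flip of a three-color move *)

Section ThreeColorFlip.

Context (V : finType) (E : {set {set V}}) (k : nat) (side : V -> bool).
Context (edge_ends : forall e : edge E, exists x y, val e = [set x; y]).
Context (side_edge :
  forall (e : edge E) x y, val e = [set x; y] -> side x != side y).

Implicit Types (u v w x y z : V) (c e f g h m : edge E).
Implicit Types (C D : colormap E k) (K F H : {set edge E}) (a b d p q : 'I_k).
Implicit Types (T U : {set V}) (S : {set 'I_k}).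

(** Membership in [F] travels backwards from the last edge. Closure is not asked at the first vertex
    [y], which will be the deficient one. *)
Lemma altpath_propagate D K H F y s es (l : edge E) : altpath D K y s es ->
  K \subset H -> last l es \in F -> (forall v, v \in s -> closed_at D H F v) ->
  forall e, e \in es -> e \in F.
Proof.
move=> ap KH; elim: s y es l ap => [|z s IH] y [|c es] l // ap lF cl.
have [cyz _ cK ap' pth] := altpath_cons ap.
have {}IH : forall e, e \in es -> e \in F.
  case: es ap' lF {ap pth} => // c2 es ap' lF; apply: (IH z _ c2) => //.
  by move=> v vs; apply: cl; rewrite inE vs orbT.
move=> e; rewrite inE => /orP[/eqP->|/IH //].
case: es ap' pth lF IH {ap} => [|c2 es] // ap' /andP[Cc _] _ IH.
have c2z : z \in val c2 by have [] := trail_ends c2 (altpath_trail ap') isT.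
apply: (cl z _ c2) => //; first exact: mem_head.
- exact/IH/mem_head.
- exact: (subsetP KH).
by rewrite cyz !inE eqxx orbT.
Qed.

Section AtDeficientVertex.

Context (D : colormap E k) (w : V) (a b d : 'I_k) (U : {set V}).
Context (bd : b != d) (ad : a != d).
Context (okD : forall v, v \notin U -> v != w -> ok_at D v).
Context (dblU : forall u, u \in U ->
  (exists e g, doubled D u a b e g) /\ side u = side w).
Context (U1 : #|U| <= 1).

Let H := color_class2 D b d.

(** The color repeated at a vertex of [U] is [a], which lies outside the class of [b] and [d]; so
    [w] is the only vertex where this class can conflict. *)
Lemma bd_unique v g h : v != w -> g \in H -> h \in H -> v \in val g ->
  v \in val h -> D g = D h -> g = h.
Proof.
move=> vw gH hH vg vh Dgh; have [vU|vU] := boolP (v \in U);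
  last exact: (okD vU vw vg vh Dgh).
have [[e1 [g1 dbl]] _] := dblU vU.
apply: (dbl_other dbl) => // Dga; case/class2P: gH => Dg.
  exact: (dbl_missing dbl vg Dg).
by case/eqP: ad; rewrite -Dga Dg.
Qed.

(** Since [b] is missing at [u], a (b, d)-path can meet [u] only as an end, through a [d]-edge. *)
Lemma bd_at_U u h : u \in U -> h \in H -> u \in val h -> D h = d.
Proof.
move=> /dblU[[e1 [g1 dbl]] _] /class2P[] // Dh uh.
by case: (dbl_missing dbl uh Dh).
Qed.

Lemma bd_unique_w e g h h' : doubled D w b a e g -> h \in H :\ g -> h' \in H :\ g ->
  w \in val h -> w \in val h' -> D h = D h' -> h = h'.
Proof.
move=> dbl; rewrite !in_setD1 => /andP[hg hH] /andP[h'g h'H] wh wh' Dhh'.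
case: (D h =P b) => [Dhb|/(dbl_other dbl wh wh' Dhh') //].
case: (dbl_only dbl wh Dhb) => [->|/eqP]; last by rewrite (negbTE hg).
by case: (@dbl_only _ _ _ _ _ _ _ _ _ dbl h') => [||->|/eqP] //;
  rewrite -?Dhh' // (negbTE h'g).
Qed.

Lemma bd_two_colored K : K \subset H -> two_colored D K.
Proof. exact: class2_two_colored. Qed.

(** Removing one of the two [b]-edges at [w] restores determinism there. *)
Lemma bd_forced e g : doubled D w b a e g -> forced D (H :\ g).
Proof.
move=> dbl v c h h' cK hK h'K vc vh vh' Ch Ch'.
have Dhh' : D h = D h' := (bd_two_colored (subD1set H g) cK hK h'K Ch Ch').
have [vw|vw] := eqVneq v w; first by subst v; apply: bd_unique_w dbl hK h'K vh vh' Dhh'.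
by apply: bd_unique vw _ _ vh vh' Dhh'; [case/setD1P: hK|case/setD1P: h'K].
Qed.

(** Closure is waived at [w], where [g] has to keep the color [b]; the [d]-edge at [w], if there is
    one, must be flipped along with [e]. Vertices of [U] are left untouched. *)
Definition good_flip e g F :=
  [/\ F \in maximal_alternating D setT b d e, e \in F /\ F \subset H :\ g,
      forall v, v != w -> closed_at D H F v,
      forall m, w \in val m -> D m = d -> m \in F
    & forall u h, u \in U -> h \in F -> u \notin val h].

Definition bd_cycle e g := exists x s es h,
  [/\ altpath D (H :\ g) x s es, closes D (H :\ g) x s es h & e \in h :: es].

Lemma doubled_in e g : doubled D w b a e g -> e \in H :\ g.
Proof.
by case=> eg _ _ De _ _ _ _; rewrite in_setD1 eg; apply/class2P; left.
Qed.

(** A cycle has edges of both colors at each of its vertices, so it contains the [d]-edge at [w] and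
    avoids [U], where [b] is missing. *)
Lemma cycle_good_flip e g : doubled D w b a e g -> bd_cycle e g ->
  exists F, good_flip e g F.
Proof.
move=> dbl [x [s [es [h [ap cl eF]]]]]; have [_ we _ De _ _ _ _] := dbl.
have inK c : c \in h :: es -> c \in H :\ g.
  by rewrite inE => /orP[/eqP->|]; [case: cl | apply: altpath_in ap].
have inH c : c \in h :: es -> c \in H by move/inK/setD1P=> [].
exists [set c in h :: es]; split.
- rewrite inE; apply/orP; left; apply: cycle_alternating ap cl (subD1set _ _) eF.
- by split; [rewrite inE | apply/subsetP=> c; rewrite inE; apply: inK].
- move=> v vw c c' + c'H vc vc' Cc'; rewrite !in_set => cF.
  have [c2 [c2F vc2 Cc2]] := cycle_opposite ap cl cF vc.
  have cH := inH _ cF; have c2H := inH _ c2F.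
  have Dc2 : D c2 = D c' := bd_two_colored (subxx H) cH c2H c'H Cc2 Cc'.
  by rewrite -(bd_unique vw c2H c'H vc2 vc' Dc2).
- move=> m wm Dm; have [c2 [c2F wc2 Cc2]] := cycle_opposite ap cl eF we.
  have /class2P[Dc2|Dc2] := inH _ c2F; first by rewrite Dc2 De eqxx in Cc2.
  rewrite inE (_ : m = c2) //; apply: (dbl_other dbl) => //; first by rewrite Dm.
  by rewrite Dm => /esym/eqP; rewrite (negbTE bd).
move=> u c uU; rewrite in_set => cF; apply/negP=> uc.
have [c2 [c2F uc2 Cc2]] := cycle_opposite ap cl cF uc.
by rewrite (bd_at_U uU (inH _ c2F) uc2) (bd_at_U uU (inH _ cF) uc) eqxx in Cc2.
Qed.

Lemma split_at_w e g x s es : doubled D w b a e g ->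
  altpath D (H :\ g) x s es -> e \in es -> last x s != w ->
  exists s2 m es2, [/\ altpath D (H :\ g) w s2 (m :: es2),
    {subset m :: es2 <= es}, last x s = last w s2, last e es = last m es2
    & w \in val m].
Proof.
move=> dbl ap ees lw; have [_ we _ _ _ _ _ _] := dbl.
have wxs := trail_mem (altpath_trail ap) ees we.
case/splitPl: wxs ap lw => s1 s2 s1w ap; rewrite last_cat s1w => lw.
have [es1 [es2 [def_es ap1 ap2]]] := altpath_suffix ap; rewrite s1w in ap2.
case: s2 es2 lw ap ap2 def_es => [|y s2] [|m es2] //= lw _ ap2 ->;
  first by rewrite eqxx in lw.
exists (y :: s2), m, es2; rewrite last_cat; split=> //.
  by move=> c; rewrite mem_cat => ->; rewrite orbT.
by have [] := trail_ends m (altpath_trail ap2) isT.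
Qed.

(** Only [g] can prolong a path with ends dead outside [g], so [g] joins the live end, reached by a
    [d]-edge, to [w]. By parity the piece of the path from [w] to that end starts with a [d]-edge;
    with [g] it forms a cycle that avoids [e]. *)
Lemma live_end_cycle e g x s es h : doubled D w b a e g ->
  altpath D (H :\ g) x s es -> e \in es -> dead_ends D (H :\ g) x s es ->
  h \in H -> last x s \in val h -> D h != D (last h es) -> bd_cycle g e.
Proof.
move=> dbl ap ees [_ dl] hH lh Ch.
have [eg we wg De Dg _ _ _] := dbl.
have hg : h = g.
  by apply: contraNeq Ch => hg; apply/eqP/dl => //; apply/setD1P.
have leq c : last c es = last e es by case: (es) ees.
rewrite hg leq Dg in lh Ch.
have lK : last e es \in H :\ g.
  by apply: (altpath_in ap); case: (es) ees => //= c es' _; apply: mem_last.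
have gH : g \in H by apply/class2P; left.
have [lw|lw] := eqVneq (last x s) w.
  have := altpath_rev ap; rewrite lw => ap'; rewrite -mem_rev in ees.
  have := altpath_head_eq e ap' ees we.
  have -> : head e (rev es) = last e es by case: (lastP es) => // *;
    rewrite rev_rcons last_rcons.
  by move=> el; rewrite -el De eqxx in Ch.
have /class2P[Dl | Dl] : last e es \in H by case/setD1P: lK.
  by rewrite Dl eqxx in Ch.
have [s2 [m [es2 [ap2 sub ls le wm]]]] := split_at_w dbl ap ees lw.
have gv : val g = [set last w s2; w].
  have [z gz] := edge_other edge_ends wg.
  move: lh; rewrite ls gz !inE => /orP[/eqP lw'|/eqP->]; last exact: setUC.
  by rewrite ls lw' eqxx in lw.
have mK : m \in H :\ g := altpath_in ap2 (mem_head _ _).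
have /class2P[Dm|Dm] : m \in H by case/setD1P: mK.
  have := altpath_side side_edge m (bd_two_colored (subD1set H g)) ap2 isT.
  by rewrite (negbTE (side_edge gv)) /= -le Dl Dm eq_sym bd.
exists w, s2, (m :: es2), g; split; last exact: mem_head.
  case/and4P: (ap2) => tr us aK srt; apply/and4P; split=> //.
  apply/allP=> c cs; rewrite /= in_setD1; have /setD1P[_ ->] := allP aK _ cs.
  rewrite andbT; apply: contraNneq bd => ce; rewrite ce in cs.
  by rewrite -De (altpath_head_eq e ap2 cs we) /= Dm.
split=> //; first by rewrite in_setD1 eq_sym eg.
  by rewrite /= Dm Dg.
by rewrite /= -le Dl Dg.
Qed.

Lemma rev_last e es : last e (rev es) = head e es.
Proof. by case: es => // c es; rewrite rev_cons last_rcons. Qed.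

Lemma dead_ends_rev K x s es : dead_ends D K x s es ->
  dead_ends D K (last x s) (rev (belast x s)) (rev es).
Proof.
move=> [dx dl]; split=> h hK.
  by move/(dl h hK)->; case: (lastP es) => // *; rewrite rev_rcons last_rcons.
by rewrite rev_belast rev_last => /(dx h hK).
Qed.

Definition bd_path e g x s es :=
  [/\ altpath D (H :\ g) x s es, e \in es & dead_ends D H x s es].

Lemma bd_path_rev e g x s es : bd_path e g x s es ->
  bd_path e g (last x s) (rev (belast x s)) (rev es).
Proof.
by case=> ap ees dead; split; [apply: altpath_rev|rewrite mem_rev|apply: dead_ends_rev].
Qed.

Lemma cycle_or_path e g : doubled D w b a e g ->
  (bd_cycle e g \/ bd_cycle g e) \/ exists x s es, bd_path e g x s es.
Proof.
move=> dbl.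
have [x [s [es [ap ees [[h cl]|dead]]]]] := altpath_component edge_ends side_edge
    (bd_two_colored (subD1set H g)) (bd_forced dbl) (doubled_in dbl).
  by left; left; exists x, s, es, h; rewrite inE ees orbT.
case: (boolP [exists h in H, (last x s \in val h) && (D h != D (last h es))]).
  case/exists_inP=> h hH /andP[lh Ch]; left; right.
  exact: live_end_cycle dbl ap ees dead hH lh Ch.
move=> /exists_inPn dl.
case: (boolP [exists h in H, (x \in val h) && (D h != D (head h es))]).
  case/exists_inP=> h hH /andP[xh Ch]; left; right.
  apply: (live_end_cycle dbl (altpath_rev ap) _ (dead_ends_rev dead) hH).
  - by rewrite mem_rev.
  - by rewrite rev_belast.
  by rewrite rev_last.
move=> /exists_inPn dx; right; exists x, s, es; split=> //.
split=> h hH vh; apply/eqP.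
  by have := dx h hH; rewrite vh negbK.
by have := dl h hH; rewrite vh negbK.
Qed.

Lemma path_closed e g x s es v : bd_path e g x s es -> v != w ->
  closed_at D H [set c in es] v.
Proof.
case=> ap ees [dx dl] vw c c' + c'H vc vc' Cc'; rewrite !in_set => cs.
have inH c2 : c2 \in es -> c2 \in H by move/(altpath_in ap)/setD1P=> [].
have hd c1 c2 : head c1 es = head c2 es by case: (es) ees.
have lt c1 c2 : last c1 es = last c2 es by case: (es) ees.
case: (altpath_inner ap cs vc) => [[vx ce]|[vl ce]|[c2 [c2s vc2 Cc2]]].
- by rewrite vx in vc'; rewrite (dx c') // ce (hd _ c) eqxx in Cc'.
- by rewrite vl in vc'; rewrite (dl c') // ce (lt _ c) eqxx in Cc'.
have cH := inH _ cs; have c2H := inH _ c2s.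
have Dc2 : D c2 = D c' := bd_two_colored (subxx H) cH c2H c'H Cc2 Cc'.
by rewrite -(bd_unique vw c2H c'H vc2 vc' Dc2).
Qed.

(** If [w] has a [d]-edge, then [w] is not an end of the path, whose ends are dead in all of [H];
    hence the path passes through that edge. *)
Lemma path_good_flip e g x s es : doubled D w b a e g -> bd_path e g x s es ->
  (forall u h, u \in U -> h \in es -> u \notin val h) ->
  good_flip e g [set c in es].
Proof.
move=> dbl bp away; have [ap ees dead] := bp; have [_ we _ De _ _ _ _] := dbl.
split.
- exact: maximal_path ap ees (subD1set _ _) dead.
- by split; [rewrite inE | apply/subsetP=> c; rewrite inE; apply: altpath_in ap].
- by move=> v; apply: path_closed bp.
- move=> m wm Dm; have mH : m \in H by apply/class2P; right.
  have Dmb : D m <> b by rewrite Dm => /esym/eqP; rewrite (negbTE bd).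
  have hd c1 c2 : head c1 es = head c2 es by case: (es) ees.
  have lt c1 c2 : last c1 es = last c2 es by case: (es) ees.
  case: (altpath_inner ap ees we) => [[wx ce]|[wl ce]|[c2 [c2s wc2 Cc2]]].
  + by case: Dmb; rewrite -De (dead.1 m) -?wx // (hd _ e) -ce.
  + by case: Dmb; rewrite -De (dead.2 m) -?wl // (lt _ e) -ce.
  have /setD1P[_ /class2P[Dc2|Dc2]] := altpath_in ap c2s;
    first by rewrite Dc2 De eqxx in Cc2.
  by rewrite inE (_ : m = c2) //; apply: (dbl_other dbl) => //; rewrite Dm.
by move=> u h uU; rewrite inE; apply: away.
Qed.

(* A path avoiding g which reaches u ends there; it must leave w by e, as the
   parity of its length tells. *)
Lemma path_to_U e g x s es u c : doubled D w b a e g -> bd_path e g x s es ->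
  u \in U -> c \in es -> u \in val c ->
  exists s2 es2, [/\ altpath D (H :\ g) w s2 (e :: es2), u = last w s2
    & u \in val (last e es2)].
Proof.
move=> dbl bp uU cs uc.
wlog ul : x s es bp cs / u = last x s.
  move=> IH; have [ap ees _] := bp.
  case: (altpath_inner ap cs uc) => [[ux _]|[ul _]|[c2 [c2s uc2]]].
  - by apply: (IH _ _ _ (bd_path_rev bp)); rewrite ?mem_rev // rev_belast.
  - exact: IH bp cs ul.
  have inH c' : c' \in es -> c' \in H by move/(altpath_in ap)/setD1P=> [].
  by rewrite (bd_at_U uU (inH _ c2s) uc2) (bd_at_U uU (inH _ cs) uc) eqxx.
have [ap ees _] := bp; have [[e1 [g1 dblu]] suw] := dblU uU.
have uw : u != w.
  apply/eqP=> uw; rewrite uw in dblu.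
  by apply: (dbl_missing dblu (dbl_in1 dbl)); apply: dbl_col1 dbl.
have [|s2 [m [es2 [ap2 sub ls le wm]]]] := split_at_w dbl ap ees; first by rewrite -ul.
have mK : m \in H :\ g := altpath_in ap2 (mem_head _ _).
have ull : u \in val (last m es2).
  by have [_] := trail_ends m (altpath_trail ap2) isT; rewrite -ls ul.
have Dl : D (last m es2) = d.
  apply: (bd_at_U uU) => //.
  by have /setD1P[] : last m es2 \in H :\ g by apply: (altpath_in ap2); apply: mem_last.
suff me : m = e by rewrite me in ap2 ull; exists s2, es2; split=> //; rewrite ul.
have := altpath_side side_edge m (bd_two_colored (subD1set H g)) ap2 isT.
rewrite /= Dl -ls -ul suw eqxx => /esym dm.
have /setD1P[mg /class2P[Dm|Dm]] := mK; last by rewrite Dm eqxx in dm.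
by case: (dbl_only dbl wm Dm) => // mg'; rewrite mg' eqxx in mg.
Qed.

(* Of the two maximal paths leaving w through f and through f', at most one can
   end in U. *)
Lemma exists_good_flip f f' : doubled D w b a f f' ->
  exists e g F, doubled D w b a e g /\ good_flip e g F.
Proof.
move=> dbl; have dbl' := doubled_sym dbl.
have cyc e g : doubled D w b a e g -> bd_cycle e g ->
    exists e g F, doubled D w b a e g /\ good_flip e g F.
  by move=> dbl1 cyc; have [F good] := cycle_good_flip dbl1 cyc; exists e, g, F.
case: (cycle_or_path dbl) => [[]|[x [s [es bp]]]]; try exact: cyc.
case: (cycle_or_path dbl') => [[]|[x' [s' [es' bp']]]]; try exact: cyc.
have [touch|away] := boolP [exists u in U, [exists h in es, u \in val h]]; last first.
  exists f, f', [set c in es]; split=> //; apply: (path_good_flip dbl bp) => u h uU hs.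
  apply: contra away => uh; apply/exists_inP; exists u => //.
  by apply/exists_inP; exists h.
exists f', f, [set c in es']; split=> //; apply: (path_good_flip dbl' bp') => u c' uU c's.
apply/negP=> uc'; case/exists_inP: touch => u' u'U /exists_inP[c cs u'c].
have uu' : u' = u.
  by have /card_le1_eqP := U1; apply.
rewrite uu' in u'c; have [s2 [es2 [ap2 ul ue]]] := path_to_U dbl bp uU cs u'c.
have fs2 : {subset f :: es2 <= H :\ f'} by move=> h; apply: altpath_in ap2.
have inH h : h \in es' -> h \in H.
  by case: bp' => ap' _ _ /(altpath_in ap')/setD1P[].
have uw : u != w.
  apply/eqP=> uw; have [[e1 [g1 dblu]] _] := dblU uU; rewrite uw in dblu.
  by apply: (dbl_missing dblu (dbl_in1 dbl)); apply: dbl_col1 dbl.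
(* Both paths reach [u] through the same [d]-edge. Tracing back from it to [w] would put [f] on the
   path that avoids [f]. *)
have lf : last f (f :: es2) \in [set h in es'].
  rewrite inE /= (_ : last f es2 = c') //.
  have lH : last f es2 \in H by case/setD1P: (fs2 _ (mem_last f es2)).
  apply: (@bd_unique u) => //; first exact: inH.
  by rewrite (bd_at_U uU lH ue) (bd_at_U uU (inH _ c's) uc').
have : f \in [set h in es'].
  apply: (altpath_propagate ap2 (subD1set H f') lf _ (mem_head _ _)) => v vs.
  apply: path_closed bp' _; case/and4P: ap2 => _ /andP[ws _] _ _.
  by apply: contraNneq ws => <-.
rewrite inE => fs'; case: bp' => ap' _ _.
by have := altpath_in ap' fs'; rewrite in_setD1 eqxx.
Qed.

End AtDeficientVertex.

End ThreeColorFlip.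

(** * Settling one color class *)

Section Connections.

Context (V : finType) (E : {set {set V}}) (k : nat).
Implicit Types (C D : colormap E k).

Definition conn n C C' := exists s : seq (colormap E k),
  [/\ path (fun D D' => proper_coloring D' && (0 < chain_step D D')%R) C s,
      last C s = C' & size s <= n].

Lemma conn_refl n C : conn n C C.
Proof. by exists [::]. Qed.

Lemma conn_trans n1 n2 C1 C2 C3 : conn n1 C1 C2 -> conn n2 C2 C3 ->
  conn (n1 + n2) C1 C3.
Proof.
move=> [s1 [p1 l1 z1]] [s2 [p2 l2 z2]]; exists (s1 ++ s2).
by rewrite cat_path p1 l1 last_cat l1 size_cat leq_add.
Qed.

Lemma conn_leq n n' C C' : n <= n' -> conn n C C' -> conn n' C C'.
Proof. by move=> nn' [s [p l z]]; exists s; split=> //; apply: leq_trans nn'. Qed.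

Lemma conn1 C C' : proper_coloring C' -> (0 < chain_step C C')%R -> conn 1 C C'.
Proof. by move=> Cp pos; exists [:: C']; rewrite /= Cp pos. Qed.

End Connections.

Section Run.

Context (V : finType) (E : {set {set V}}) (k : nat) (side : V -> bool).
Context (edge_ends : forall e : edge E, exists x y, val e = [set x; y]).
Context (side_edge :
  forall (e : edge E) x y, val e = [set x; y] -> side x != side y).

Implicit Types (u v w x y z : V) (e f g h m : edge E).
Implicit Types (C D : colormap E k) (K F H : {set edge E}) (c d p q : 'I_k).
Implicit Types (T U : {set V}).

Context (C2 : colormap E k) (ok2 : forall v, ok_at C2 v).
Context (S : {set 'I_k}) (a : 'I_k) (aS : a \notin S).

Definition keeps D := forall f, C2 f \in S -> D f = C2 f.

(** The second clause guarantees that a wrong edge has a color outside [S], which can then serve as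
    the second color [b] of a run. *)
Definition inv D := keeps D /\ forall f, C2 f = a -> D f \notin S.

Definition wrong D := [set f : edge E | (C2 f == a) && (D f != a)].

(** The edges of [Y] have distinct [C2]-colors in [Q], so [Y] is no larger than [Q]. If every color
    of [Q] were present at [v] under [D], it would occur on [Y] without [f0], and [Q] would be
    smaller than [Y]. *)
Lemma missing_color v (Q : {set 'I_k}) (Y : {set edge E}) D f0 :
  (forall f, f \in Y -> v \in val f /\ C2 f \in Q) -> f0 \in Y ->
  (forall f, v \in val f -> D f \in Q ->
     exists2 f1, f1 \in Y :\ f0 & D f1 = D f) ->
  exists2 d, d \in Q & forall f, v \in val f -> D f <> d.
Proof.
move=> YQ f0Y cover.
case: (pickP [pred d | (d \in Q) && [forall f : edge E, (v \in val f) ==> (D f != d)]]) => [d|none].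
  case/andP=> dQ /forallP H; exists d => // f vf; apply/eqP.
  by have := H f; rewrite vf.
have QY : Q \subset D @: (Y :\ f0).
  apply/subsetP=> d dQ; have /negbT := none d; rewrite /= dQ negb_forall.
  case/existsP=> f; rewrite negb_imply negbK => /andP[vf /eqP Df].
  have [|f1 f1Y Df1] := cover f vf; first by rewrite Df.
  by apply/imsetP; exists f1; rewrite // Df1.
have Y2 : #|C2 @: Y| = #|Y|.
  apply: card_in_imset => f g /YQ[vf _] /YQ[vg _]; exact: ok2 vf vg.
have YQ' : C2 @: Y \subset Q by apply/subsetP=> d /imsetP[f /YQ[_ ?] ->].
have := subset_leq_card YQ'; rewrite Y2 leqNgt => /negP[].
apply: leq_ltn_trans (subset_leq_card QY) _.
apply: leq_ltn_trans (leq_imset_card _ _) _.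
by rewrite (cardsD1 f0 Y) f0Y.
Qed.

Lemma keeps_flip D p q F : keeps D -> p \notin S -> q \notin S ->
  F \subset color_class2 D p q -> keeps (flip D p q F).
Proof.
move=> kD pS qS /subsetP FK f fS; rewrite flipE; case: ifP => [/FK/class2P Df|_];
  last exact: kD.
by case: Df => Df; move: (kD f fS); rewrite Df => E';
  rewrite -E' ?(negbTE pS) ?(negbTE qS) in fS.
Qed.

Lemma inv_flip D p q F : inv D -> p \notin S -> q \notin S ->
  F \subset color_class2 D p q -> inv (flip D p q F).
Proof.
move=> [kD iD] pS qS FK; split; first exact: keeps_flip.
move=> f fa; rewrite flipE; case: ifP => [/(subsetP FK)/class2P[]->|_]; last exact: iD.
  by rewrite tpermL.
by rewrite tpermR.
Qed.

Lemma wrong_flip D p q F : p != a -> q != a ->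
  F \subset color_class2 D p q -> wrong (flip D p q F) = wrong D.
Proof.
move=> pa qa /subsetP FK; apply/setP=> f; rewrite !inE flipE.
case: ifP => // /FK/class2P[]->; first by rewrite tpermL pa qa.
by rewrite tpermR pa qa.
Qed.

(** * A run with the colors a and b *)

Section WithSecondColor.

Context (b : 'I_k) (ba : b != a) (bS : b \notin S).

(* C steps to every coloring obtained from D by elimination. *)
Definition leads C D := forall C',
  (forall S' : {set 'I_k}, a \in S' -> b \in S' -> (0 < eliminate S' D C')%R) ->
  (0 < chain_step C C')%R.

Lemma leads2 C D D' : reach C D a b -> (0 < recolor2 a b D D')%R -> leads C D'.
Proof.
move=> [CD _] DD' C' el; apply: chain_step2 CD DD' (el _ _ _);
  rewrite ?inE ?eqxx ?orbT //.
by rewrite eq_sym.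
Qed.

Lemma leads3 C D D' d : reach C D a b -> d != a -> d != b ->
  (0 < recolor3 a b d D D')%R -> leads C D'.
Proof.
move=> [_ CD] da db DD' C' el; apply: chain_step3 CD DD' (el _ _ _);
  rewrite ?inE ?eqxx ?orbT //.
by rewrite /= !inE (eq_sym a) (negbTE ba) (eq_sym a) (negbTE da) (eq_sym b) (negbTE db).
Qed.

Lemma leads_proper C D : leads C D -> proper_coloring D -> conn 1 C D.
Proof.
move=> CD Dp; apply: conn1 => //; apply: CD => S' _ _.
by apply: (@eliminate_proper _ _ _ 0) => //; apply: ret_pos.
Qed.

Lemma leads_settle C D T : leads C D -> almost D a b T -> #|T| <= 2 ->
  exists2 C', conn 1 C C' & reach C' D a b.
Proof.
move=> CD al T2; have ab : a != b by rewrite eq_sym.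
have [C' [C'p C'D el]] := settle edge_ends side_edge ab al T2.
by exists C' => //; apply: conn1 => //; apply: CD.
Qed.

(** One of the two [a]-edges is settled for good; as [C2] is proper, the other is not in the target
    class and may give up [a]. *)
Definition plus_at D v := exists e g, doubled D v a b e g /\ C2 e = a.

Definition plus_set D U := (forall u, u \in U -> plus_at D u) /\ #|U| <= 1.

(** [v] is the deficiency being moved and [U] holds the one that waits, if any. Crossing an edge
    leads between this state and [minus_state], which turns opposite sides into equal ones and
    back. *)
Definition plus_state D U v :=
  [/\ v \notin U, plus_at D v, forall x, x \notin U -> x != v -> ok_at D x,
      plus_set D U & forall u, u \in U -> side u != side v].

Definition minus_state D U w :=
  [/\ exists e g, doubled D w b a e g,
      forall x, x \notin U -> x != w -> ok_at D x,
      plus_set D U & forall u, u \in U -> side u = side w].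

Definition rest_state D U :=
  (forall x, x \notin U -> ok_at D x) /\ plus_set D U.

(* The bookkeeping of a run: three steps per wrong edge put right, up to two
   for each (+a-b)-deficiency and one for each (+b-a)-deficiency. *)
Definition ends C N M := exists C' n,
  [/\ proper_coloring C', inv C', #|wrong C'| <= M, conn n C C'
    & n + 3 * #|wrong C'| <= N].

Lemma ends_step C C' N N' M M' : conn 1 C C' -> ends C' N M -> N < N' -> M <= M' ->
  ends C N' M'.
Proof.
move=> CC' [C3 [n [C3p C3i w3 C'C3 le]]] NN' MM'; exists C3, n.+1; split=> //.
- exact: leq_trans MM'.
- exact: conn_trans CC' C'C3.
by rewrite addSn; apply: leq_ltn_trans le NN'.
Qed.

Lemma ends_leq C N N' M M' : ends C N M -> N <= N' -> M <= M' -> ends C N' M'.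
Proof.
move=> [C3 [n [C3p C3i w3 C'C3 le]]] NN' MM'; exists C3, n; split=> //.
  exact: leq_trans MM'.
exact: leq_trans NN'.
Qed.

Lemma plus_not_minus D v e g : plus_at D v -> ~ doubled D v b a e g.
Proof.
move=> [e1 [g1 [dbl _]]] dbl'; apply: (dbl_missing dbl' (dbl_in1 dbl)).
exact: dbl_col1 dbl.
Qed.

Lemma minus_notin D U w : minus_state D U w -> w \notin U.
Proof.
move=> [[e [g dbl]] _ [pU _] _]; apply/negP=> /pU pw; exact: plus_not_minus pw dbl.
Qed.

Lemma plus_almost D U v : plus_state D U v -> almost D a b (v |: U) /\ #|v |: U| <= 2.
Proof.
move=> [vU pv ok [pU U1] _]; split; last by rewrite cardsU1 vU.
split=> x; rewrite in_setU1.
  by rewrite negb_or => /andP[xv xU]; apply: ok.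
by case/orP=> [/eqP->|/pU [e [g [dbl _]]]]; [case: pv => e [g [dbl _]]|];
  exists e, g; left.
Qed.

Lemma minus_almost D U v : minus_state D U v -> almost D a b (v |: U) /\ #|v |: U| <= 2.
Proof.
move=> Sm; have vU := minus_notin Sm; case: Sm => [[e0 [g0 dbl0]] ok [pU U1] _].
split; last by rewrite cardsU1 vU.
split=> x; rewrite in_setU1.
  by rewrite negb_or => /andP[xv xU]; apply: ok.
case/orP=> [/eqP->|/pU [e [g [dbl _]]]]; first by exists e0, g0; right.
by exists e, g; left.
Qed.

Lemma plus_ext D D' v : (forall h, v \in val h -> D' h = D h) ->
  plus_at D v -> plus_at D' v.
Proof.
move=> ext [e [g [dbl Ce]]]; exists e, g; split=> //; exact: doubled_ext ext dbl.
Qed.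

Lemma rest_proper D : rest_state D set0 -> proper_coloring D.
Proof. by case=> ok _; apply/proper_coloringP=> v; apply: ok; rewrite inE. Qed.

Lemma rest_plus D U u : rest_state D U -> u \in U -> plus_state D set0 u.
Proof.
move=> [ok [pU U1]] uU; have Uu x : x \in U -> x = u.
  by move=> xU; have /card_le1_eqP := U1; apply.
split=> [|||| x]; rewrite ?inE //.
- exact: pU.
- move=> x _ xu; apply: ok; apply: contra xu => /Uu->; exact: eqxx.
by split=> [x|]; rewrite ?inE // cards0.
Qed.

(** [n] is the induction parameter: the claim covers the states whose budget is below [n]. The
    waiting deficiency is charged 2, like an active (+a-b). *)
Definition plus_bound n := forall C D U v,
  reach C D a b -> inv D -> plus_state D U v -> 3 * #|wrong D| + 2 + 2 * #|U| < n ->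
  ends C (3 * #|wrong D| + 2 + 2 * #|U|) #|wrong D|.

Definition minus_bound n := forall C D U w,
  reach C D a b -> inv D -> minus_state D U w -> 3 * #|wrong D| + 1 + 2 * #|U| < n ->
  ends C (3 * #|wrong D| + 1 + 2 * #|U|) #|wrong D|.

Section Induction.

Context (n : nat) (IHplus : plus_bound n) (IHminus : minus_bound n).

(** The summand 1 is the step already under way. A waiting deficiency now becomes the active one,
    and its charge 2 is its budget. *)
Lemma run_rest C D U : leads C D -> inv D -> rest_state D U ->
  3 * #|wrong D| + 2 * #|U| < n ->
  ends C (3 * #|wrong D| + 1 + 2 * #|U|) #|wrong D|.
Proof.
move=> CD iD rest lt; have [U0|/set0Pn[u uU]] := eqVneq U set0.
  exists D, 1; rewrite U0 in rest; have Dp := rest_proper rest.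
  split=> //; first exact: leads_proper.
  by rewrite U0 cards0 muln0 addn0 addnC.
have U1 : #|U| = 1.
  by apply/eqP; rewrite eqn_leq rest.2.2; apply/card_gt0P; exists u.
have Sp := rest_plus rest uU; have [al T2] := plus_almost Sp.
have [C' CC' C'D] := leads_settle CD al T2.
apply: ends_step CC' (IHplus C'D iD Sp _) _ _ => //; rewrite cards0 muln0 addn0.
  by rewrite U1 in lt.
by rewrite U1 -addnA ltn_add2l.
Qed.

Lemma run_plus C D U v : reach C D a b -> inv D -> plus_state D U v ->
  3 * #|wrong D| + 2 + 2 * #|U| <= n ->
  ends C (3 * #|wrong D| + 2 + 2 * #|U|) #|wrong D|.
Proof.
move=> CD iD Sp lt; have [vU [e [g [dbl Ce]]] ok [pU U1] sU] := Sp.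
have [eg ve vg De Dg _ _ _] := dbl.
have Cg : C2 g <> a.
  by move=> Cg; case/eqP: eg; apply: (ok2 ve vg); rewrite Ce.
set D' := flip D a b [set g].
have CD' : leads C D'.
  by apply: (leads2 CD); apply: recolor2_deficient (doubled_sym dbl).
have gK : [set g] \subset color_class2 D a b.
  by rewrite sub1set; apply/class2P; left.
have iD' : inv D' by apply: inv_flip.
have wD' : wrong D' = wrong D.
  apply/setP=> f; rewrite !in_set flipE in_set1.
  by case: (f =P g) => // ->; move/eqP/negbTE: Cg => ->.
have ab : a != b by rewrite eq_sym.
have okv : ok_at D' v.
  apply: (flip_doubled (doubled_sym dbl)) => //; first by rewrite in_set1.
  by move=> h /set1P.
have [z gz] := edge_other edge_ends vg; have vz := side_edge gz.
have zv : z != v by apply: contraNneq vz => ->.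
have ext x : x != v -> x != z -> forall h, x \in val h -> D' h = D h.
  move=> xv xz h; apply: flip_away => g' /set1P->.
  by rewrite gz !inE negb_or xv xz.
have zg : z \in val g by rewrite gz !inE eqxx orbT.
(* If [g] runs into the waiting deficiency, it must be the [a]-edge there outside the target class,
   so this recoloring resolves both at once. *)
have [zU|zU] := boolP (z \in U).
  have Uz x : x \in U -> x = z by move=> xU; have /card_le1_eqP := U1; apply.
  have rest : rest_state D' set0.
    split; last by split=> [x|]; rewrite ?inE ?cards0.
    move=> x _; have [->//|xv] := eqVneq x v.
    have [->|xz] := eqVneq x z; last first.
      apply: ok_ext (ext x xv xz) (ok x _ xv).
      by apply: contra xz => /Uz->.
    have [e1 [g1 [dbl1 Ce1]]] := pU z zU.
    have g1g : g1 = g.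
      by case: (dbl_only dbl1 zg Dg) => // ge1; case: Cg; rewrite ge1.
    rewrite g1g in dbl1; apply: (flip_doubled (doubled_sym dbl1)) => //.
      by rewrite in_set1.
    by move=> h /set1P.
  have := run_rest CD' iD' rest; rewrite wD' cards0 muln0 !addn0 => H.
  apply: ends_leq (H _) _ _ => //.
    by apply: leq_trans lt; rewrite -addn1 -addnA leq_add2l.
  by rewrite -addnA leq_add2l.
have pU' : plus_set D' U.
  split=> // u uU; apply: plus_ext (pU u uU); apply: ext.
    by apply: contraNneq vU => <-.
  by apply: contraNneq zU => <-.
have okx x : x \notin U -> x != z -> ok_at D' x.
  move=> xU xz; have [->//|xv] := eqVneq x v.
  exact: ok_ext (ext x xv xz) (ok x xU xv).
case: (recolor_ok (ok z zU zv) zg Dg ab) => [okz|[g1 dbl1]].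
  have rest : rest_state D' U.
    split=> // x xU; have [->//|xz] := eqVneq x z; exact: okx.
  have := run_rest CD' iD' rest; rewrite wD' => H.
  apply: ends_leq (H _) _ _ => //; last by rewrite leq_add2r leq_add2l.
  by apply: leq_trans lt; rewrite -addnA -addnS leq_add2l; apply: leqnSn.
have Sm : minus_state D' U z.
  split=> //; first by exists g, g1.
  by move=> u uU; have := sU u uU; move: vz; case: (side u); case: (side v);
    case: (side z).
have [al T2] := minus_almost Sm.
have [C' CC' C'D'] := leads_settle CD' al T2.
apply: ends_step CC' (IHminus C'D' iD' Sm _) _ _; rewrite ?wD' //.
  by apply: leq_trans lt; rewrite ltn_add2r ltn_add2l.
by rewrite ltn_add2r ltn_add2l.
Qed.

(** One wrong edge fewer releases 3: one pays for this step, two for the (+a-b)-deficiency that may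
    appear at the other end of [m]. *)
Lemma run_recolor C D U w m g : reach C D a b -> inv D -> minus_state D U w ->
  doubled D w b a m g -> C2 m = a -> 3 * #|wrong D| + 2 * #|U| <= n ->
  ends C (3 * #|wrong D| + 2 * #|U|) #|wrong D|.
Proof.
move=> CD iD Sm dbl Cm lt; have wU := minus_notin Sm.
have [_ ok [pU U1] sU] := Sm; have [mg wm wg Dm Dg _ _ _] := dbl.
set D' := flip D b a [set m].
have CD' : leads C D'.
  by apply: (leads2 CD); rewrite /D' flipC; apply: recolor2_deficient dbl.
have mK : [set m] \subset color_class2 D b a.
  by rewrite sub1set; apply/class2P; left.
have iD' : inv D' by apply: inv_flip.
have wD : #|wrong D| = #|wrong D'|.+1.
  rewrite (cardsD1 m (wrong D)) inE Cm Dm eqxx ba; congr _.+1.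
  apply: eq_card => f; rewrite !in_set flipE in_set1.
  by case: (f =P m) => // ->; rewrite Dm tpermL eqxx andbF.
have okw : ok_at D' w.
  apply: (flip_doubled dbl) => //; first by rewrite in_set1.
  by move=> h /set1P.
have [z mz] := edge_other edge_ends wm; have wz := side_edge mz.
have zw : z != w by apply: contraNneq wz => ->.
have ext x : x != w -> x != z -> forall h, x \in val h -> D' h = D h.
  move=> xw xz h; apply: flip_away => g' /set1P->.
  by rewrite mz !inE negb_or xw xz.
have zm : z \in val m by rewrite mz !inE eqxx orbT.
(* [z] is across an edge from [w], while [U] is on the side of [w]. *)
have zU : z \notin U by apply: contra wz => /sU->.
have pU' : plus_set D' U.
  split=> // u uU; apply: plus_ext (pU u uU); apply: ext.
    by apply: contraNneq wU => <-.
  by apply: contraNneq zU => <-.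
have okx x : x \notin U -> x != z -> ok_at D' x.
  move=> xU xz; have [->//|xw] := eqVneq x w.
  exact: ok_ext (ext x xw xz) (ok x xU xw).
case: (recolor_ok (ok z zU zw) zm Dm ba) => [okz|[g1 dbl1]].
  have rest : rest_state D' U.
    split=> // x xU; have [->//|xz] := eqVneq x z; exact: okx.
  apply: ends_leq (run_rest CD' iD' rest _) _ _; last by rewrite wD.
    by apply: leq_trans lt; rewrite ltn_add2r ltn_pmul2l ?wD.
  by rewrite leq_add2r addn1 ltn_pmul2l ?wD.
have Sp : plus_state D' U z.
  split=> //; first by exists m, g1.
  by move=> u /sU->.
have [al T2] := plus_almost Sp.
have [C' CC' C'D'] := leads_settle CD' al T2.
have lt3 : 3 * #|wrong D'| + 2 < 3 * #|wrong D| by rewrite wD mulnS addnC ltn_add2r.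
apply: ends_step CC' (IHplus C'D' iD' Sp _) _ _; last by rewrite wD.
  by apply: leq_trans lt; rewrite ltn_add2r.
by rewrite ltn_add2r.
Qed.

Lemma good_flip_effect D U w d e g F : inv D -> minus_state D U w ->
  doubled D w b a e g -> d \notin S -> d != a -> good_flip D w b d U e g F ->
  let D' := flip D b d F in
  [/\ inv D', wrong D' = wrong D, forall x, x \notin U -> x != w -> ok_at D' x
    & plus_set D' U].
Proof.
move=> iD [_ ok [pU U1] _] dbl dS da [_ [_ FH] cl _ away].
have FH' : F \subset color_class2 D b d := subset_trans FH (subD1set _ _).
split.
- exact: inv_flip.
- exact: wrong_flip.
- by move=> x xU xw; apply: flip_ok FH' (cl x xw) (ok x xU xw).
split=> // u uU; apply: plus_ext (pU u uU) => h uh; apply: flip_away uh => f fF.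
exact: away uU fF.
Qed.

Lemma run_minus C D U w : reach C D a b -> inv D -> minus_state D U w ->
  3 * #|wrong D| + 1 + 2 * #|U| <= n ->
  ends C (3 * #|wrong D| + 1 + 2 * #|U|) #|wrong D|.
Proof.
move=> CD iD Sm; rewrite addnAC addn1 => lt.
have wU := minus_notin Sm; have [[e [g dbl]] ok [pU U1] sU] := Sm.
have dblU u : u \in U -> (exists e g, doubled D u a b e g) /\ side u = side w.
  by move=> uU; split; [have [e1 [g1 [dbl1 _]]] := pU u uU; exists e1, g1 | apply: sU].
have recolor C' D' m g' : reach C' D' a b -> inv D' -> minus_state D' U w ->
    doubled D' w b a m g' -> C2 m = a -> wrong D' = wrong D ->
    ends C' (3 * #|wrong D| + 2 * #|U|) #|wrong D|.
  move=> CD' iD' Sm' dbl' Cm wE; rewrite -wE.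
  by apply: (run_recolor CD' iD' Sm' dbl' Cm); rewrite wE ltnW.
have [m /andP[wm /eqP Cm]|nom] := pickP (fun m => (w \in val m) && (C2 m == a)).
  have [Dm|Dmb] := eqVneq (D m) b.
    apply: (@ends_leq _ (3 * #|wrong D| + 2 * #|U|) _ #|wrong D|) => //.
    case: (dbl_only dbl wm Dm) => mE.
      by rewrite mE in Cm; exact: (recolor _ _ _ _ CD iD Sm dbl Cm).
    by rewrite mE in Cm; exact: (recolor _ _ _ _ CD iD Sm (doubled_sym dbl) Cm).
  have da : D m != a by apply/eqP/(dbl_missing dbl).
  have dS : D m \notin S by apply: iD.2.
  have bd : b != D m by rewrite eq_sym.
  have ad : a != D m by rewrite eq_sym.
  have [e' [g' [F [dbl' good]]]] :=
    exists_good_flip edge_ends side_edge bd ad ok dblU U1 dbl.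
  have [iD' wD' ok' pU'] := good_flip_effect iD Sm dbl' dS da good.
  have [Fmax [e'F FH] _ mF _] := good.
  set D' := flip D b (D m) F in iD' wD' ok' pU'.
  have dbl1 : doubled D' w b a m g'.
    apply: (flip_doubled3 dbl') => //; first exact: mF.
    move=> h hF wh; have /setD1P[hg /class2P[Dh|Dh]] := subsetP FH h hF.
      by case: (dbl_only dbl' wh Dh) => [|hg']; [left | rewrite hg' eqxx in hg].
    by right; apply: (dbl_other dbl') => //; rewrite Dh; apply/eqP.
  have Sm' : minus_state D' U w by split=> //; exists m, g'.
  have CD' : leads C D'.
    by apply: (leads3 CD da Dmb); apply: recolor3_deficient dbl' Fmax.
  have [al T2] := minus_almost Sm'.
  have [C' CC' C'D'] := leads_settle CD' al T2.
  exact: ends_step CC' (recolor _ _ _ _ C'D' iD' Sm' dbl1 Cm wD') _ _.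
have [eg we wg De Dg _ _ _] := dbl.
have Qb : b \in ~: (a |: S) by rewrite !inE negb_or ba.
have [d] : exists2 d, d \in ~: (a |: S) & forall f, w \in val f -> D f <> d.
  (* No edge of the target class is at [w], so the edges there with [D]-color outside [a |: S] have
     such [C2]-colors too. As [b] is repeated among them, [e] can be spared. *)
  apply: (@missing_color w _ [set f : edge E | (w \in val f) && (D f \in ~: (a |: S))] D e).
  - move=> f; rewrite inE => /andP[wf]; rewrite !inE !negb_or => /andP[Dfa DfS];
      split=> //.
    apply/andP; split; first by have /negbT := nom f; rewrite wf.
    by apply: contra DfS => fS; rewrite iD.1.
  - by rewrite inE we De.
  move=> f wf DfQ; have [->|fe] := eqVneq f e; last by exists f;
    rewrite // in_setD1 fe inE wf.
  by exists g; rewrite ?De // in_setD1 eq_sym eg inE wg Dg.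
rewrite !inE negb_or => /andP[da dS] miss.
have bd : b != d by apply/eqP=> bd; apply: (miss e); rewrite ?De.
have ad : a != d by rewrite eq_sym.
have [e' [g' [F [dbl' good]]]] :=
  exists_good_flip edge_ends side_edge bd ad ok dblU U1 dbl.
have [iD' wD' ok' pU'] := good_flip_effect iD Sm dbl' dS da good.
have [Fmax [e'F FH] _ _ _] := good.
set D' := flip D b d F in iD' wD' ok' pU'.
(* With [d] missing, the deficiency is also a (+b-d), so giving [d] to [e'] alone resolves it. *)
have okw : ok_at D' w.
  apply: (flip_doubled (doubled_missing dbl' miss)) => // h hF wh.
  have /setD1P[hg /class2P[Dh|Dh]] := subsetP FH h hF; last by case: (miss h wh).
  by case: (dbl_only dbl' wh Dh) => // hg'; rewrite hg' eqxx in hg.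
have rest : rest_state D' U.
  by split=> // x xU; have [->//|xw] := eqVneq x w; apply: ok'.
have CD' : leads C D'.
  apply: (leads3 CD da); first by rewrite eq_sym.
  exact: recolor3_deficient dbl' Fmax.
by rewrite -addn1 addnAC -wD'; apply: run_rest CD' iD' rest _; rewrite wD'.
Qed.

End Induction.

Lemma run_bounds n : plus_bound n /\ minus_bound n.
Proof.
elim: n => [|n [IHp IHm]]; first by split.
split=> C D U v CD iD St lt; first exact: (run_plus IHp IHm CD iD St).
exact: (run_minus IHp CD iD St).
Qed.

(** If recoloring [m] creates a deficiency, it is an opening flip and takes no step. In the worst
    case both ends are deficient, and with one wrong edge fewer the budget 3 + 1 covers 2 + 2.
    Otherwise a single two-color move does it. *)
Lemma fix_edge C m : proper_coloring C -> inv C -> m \in wrong C -> C m = b ->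
  ends C (3 * #|wrong C| + 1) #|wrong C|.-1.
Proof.
move=> /proper_coloringP ok iC mw Cm; move: (mw); rewrite inE => /andP[/eqP C2m _].
have [x [y mxy]] := edge_ends m; have xy := side_edge mxy.
pose D := flip C b a [set m].
have mK : [set m] \subset color_class2 C b a.
  by rewrite sub1set; apply/class2P; left.
have iD : inv D by apply: inv_flip.
have wD : #|wrong C| = #|wrong D|.+1.
  rewrite (cardsD1 m (wrong C)) mw; congr _.+1.
  apply: eq_card => f; rewrite !in_set flipE in_set1.
  by case: (f =P m) => // ->; rewrite Cm tpermL eqxx andbF.
rewrite wD /= mulnS.
have ap : altpath C (color_class2 C a b) x [:: y] [:: m].
  rewrite /altpath /= mxy eqxx /= !inE Cm eqxx orbT !andbT.
  by apply: contraNneq xy => ->.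
have mH : [set m] \in subpaths (color_class2 C a b).
  have -> : [set m] = [set e in [:: m]] by apply/setP=> e; rewrite !inE.
  apply: subpath_altpath ap _ _ => //.
  by apply/subsetP=> e; rewrite !inE => /eqP->; rewrite Cm eqxx orbT.
have ends_m : end_vertices [set m] = [set x; y].
  have -> : [set m] = [set e in [:: m]] by apply/setP=> e; rewrite !inE.
  by rewrite (altpath_ends ap).
have okx v : v != x -> v != y -> ok_at D v.
  move=> vx vy; apply: ok_ext (ok v) => h; apply: flip_away => g /set1P->.
  by rewrite mxy !inE negb_or vx vy.
have xm : x \in val m by rewrite mxy !inE eqxx.
have ym : y \in val m by rewrite mxy !inE eqxx orbT.
(* A deficient end of [m] has two [a]-edges, so it is not an end of the color class, and flipping
   the one-edge path [m] is legal for either kind of move. *)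
have reachD v h : v \in val m -> doubled D v a b m h -> reach C D a b.
  move=> vm dbl; apply: (reach_path mH (w := v)).
  - by rewrite ends_m -mxy.
  - have <- : color_class2 D a b = color_class2 C a b.
      by rewrite color_class2C flip_class2 color_class2C.
    have [mh _ vh Dm Dh _ _ _] := dbl.
    by apply: (end_vertices_other _ _ mh vm vh); apply/class2P; left.
  exact: flipC.
have run U v : reach C D a b -> plus_state D U v -> ends C (3 * #|wrong D| + 2 + 2 * #|U|) #|wrong D|.
  move=> CD Sp; have [bound _] := run_bounds (3 * #|wrong D| + 2 + 2 * #|U|).+1.
  exact: bound Sp _.
have plus_m v h : doubled D v a b m h -> plus_at D v by exists m, h.
have U0 : plus_set D set0 by split=> [u|]; rewrite ?inE ?cards0.
case: (recolor_ok (ok x) xm Cm ba) => [okx1|[h1 dbl1]];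
  case: (recolor_ok (ok y) ym Cm ba) => [oky1|[h2 dbl2]].
- have Dp : proper_coloring D.
    apply/proper_coloringP=> v; have [->//|vx] := eqVneq v x.
    by have [->//|vy] := eqVneq v y; apply: okx.
  have CD : leads C D.
    apply: (leads2 (reach_refl C a b)); rewrite /D flipC.
    apply: recolor2_proper_edge; first exact/proper_coloringP.
    by apply/class2P; right.
  exists D, 1; split=> //; first exact: leads_proper.
  by rewrite add1n addn1 ltnS leq_addl.
- apply: ends_leq (run set0 y (reachD _ _ ym dbl2) _) _ _ => //.
    split; rewrite ?inE //; first exact: plus_m dbl2.
    + by move=> v _ vy; have [->//|vx] := eqVneq v x; apply: okx.
    by move=> u; rewrite inE.
  by rewrite cards0 muln0 addn0 [3 + _]addnC -addnA leq_add2l.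
- apply: ends_leq (run set0 x (reachD _ _ xm dbl1) _) _ _ => //.
    split; rewrite ?inE //; first exact: plus_m dbl1.
    + by move=> v _ vx; have [->//|vy] := eqVneq v y; apply: okx.
    by move=> u; rewrite inE.
  by rewrite cards0 muln0 addn0 [3 + _]addnC -addnA leq_add2l.
(* Both ends are deficient: [y] is moved first while [x] waits on the other side. *)
apply: ends_leq (run [set x] y (reachD _ _ ym dbl2) _) _ _ => //.
  split.
  - by rewrite inE; apply: contraNneq xy => ->.
  - exact: plus_m dbl2.
  - by move=> v; rewrite inE; apply: okx.
  - by split=> [u /set1P->|]; [apply: plus_m dbl1 | rewrite cards1].
  by move=> u /set1P->.
by rewrite cards1 muln1 -addnA [3 + _]addnC -addnA leq_add2l.
Qed.

End WithSecondColor.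

(** A run puts at least one edge right, so its overhead of one step raises the cost per edge from 3
    to at most 4. *)
Lemma fix_color C : proper_coloring C -> inv C ->
  exists2 C', [/\ proper_coloring C', inv C' & wrong C' = set0]
    & conn (4 * #|wrong C|) C C'.
Proof.
have [n] := ubnP #|wrong C|; elim: n C => // n IH C; rewrite ltnS => le Cp iC.
have [w0|/set0Pn[m mw]] := eqVneq (wrong C) set0.
  by exists C; [split | apply: conn_refl].
have [/eqP C2m Cma] : C2 m == a /\ C m != a by move: mw; rewrite inE => /andP.
have CmS := iC.2 m C2m.
have w0 : 0 < #|wrong C| by apply/card_gt0P; exists m.
have [C1 [i [C1p iC1 w1 CC1 le1]]] := fix_edge Cma CmS Cp iC mw (erefl _).
have lt1 : #|wrong C1| < #|wrong C| by rewrite -(prednK w0) ltnS.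
have [C' C'P C1C'] := IH C1 (leq_trans lt1 le) C1p iC1.
exists C' => //; apply: conn_leq (conn_trans CC1 C1C').
rewrite !(mulSn 3) addnCA; apply: leq_trans (leq_add (leqnn _) le1) _.
by rewrite addnCA addn1 [#|wrong C| + _]addnC leq_add2l.
Qed.

(* By bipartiteness the Kempe chain of p and q starting at x does not reach the
   neighbour y of x. *)
Lemma kempe C p q x y m : proper_coloring C -> p != q -> val m = [set x; y] ->
  (forall h, x \in val h -> C h <> p) -> (forall h, y \in val h -> C h <> q) ->
  exists F, let D := flip C p q F in
    [/\ F \subset color_class2 C p q, proper_coloring D, conn 1 C D
      & forall h, x \in val h \/ y \in val h -> D h <> q].
Proof.
move=> Cp pq mxy missp missq; have xy := side_edge mxy.
have ok := elimT (proper_coloringP C) Cp.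
case: (pickP (fun f : edge E => (x \in val f) && (C f == q))) =>
  [f0 /andP[xf0 /eqP Cf0]|noq]; last first.
  exists set0; have -> : flip C p q set0 = C by apply/ffunP=> f; rewrite flipE inE.
  split=> //; [exact: sub0set | exact: conn_leq (conn_refl 0 C) |].
  by move=> h [xh|/missq//] /eqP Ch; have := noq h; rewrite xh Ch.
pose H := color_class2 C p q; have HH : H \subset H := subxx H.
have tc : two_colored C H := class2_two_colored HH.
have fo : forced C H.
  by apply: (@almost_forced _ _ _ C p q set0); split=> v; rewrite inE //; move=> _;
    apply: ok.
have f0H : f0 \in H by apply/class2P; right.
have xq h : h \in H -> x \in val h -> C h = q by move=> /class2P[] // Ch /missp.
have yp h : h \in H -> y \in val h -> C h = p by move=> /class2P[] // Ch /missq.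
have [x1 [s [es [ap fes [[h cl]|dead]]]]] := altpath_component edge_ends side_edge tc fo f0H.
  have [|h' [h's xh' /eqP[]]] := cycle_opposite ap cl (_ : f0 \in h :: es) xf0.
    by rewrite inE fes orbT.
  rewrite Cf0; apply: xq xh'; move: h's; rewrite inE => /orP[/eqP->|]; first by case: cl.
  exact: altpath_in ap.
wlog x1x : x1 s es ap fes dead / x = x1.
  move=> IH; case: (altpath_inner ap fes xf0) => [[xx _]|[xl _]|[h [hs xh /eqP[]]]].
  - exact: IH ap fes dead xx.
  - apply: (IH _ _ _ (altpath_rev ap)); rewrite ?mem_rev //.
    exact: dead_ends_rev.
  by rewrite Cf0; apply: xq xh; apply: altpath_in ap hs.
rewrite -x1x in ap dead; have es0 : es != [::] by case: (es) fes.
have FH : [set e in es] \subset H.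
  by apply/subsetP=> e; rewrite inE; apply: altpath_in ap.
exists [set e in es] => D.
have Dp : proper_coloring D.
  by apply/proper_coloringP=> v; apply: flip_ok => //; apply: closed_path ap dead.
split=> //.
  apply: conn1 => //; apply: chain_step2 pq _ (recolor2_proper _ _ Dp) _.
    by apply: phase2_path (erefl _); apply: subpath_altpath ap es0 FH.
  by apply: (@eliminate_proper _ _ _ 0) => //; apply: ret_pos.
have Cq h : h \notin es -> D h = C h.
  by move=> hs; rewrite /D flipE inE (negbTE hs).
move=> h; have [hs|hs] := boolP (h \in es); last first.
  rewrite (Cq h hs) => -[xh Chq|/missq//]; case/negP: hs.
  by rewrite (ok x h f0) ?Cf0.
have hH : h \in H by apply: (subsetP FH); rewrite inE.
rewrite /D flipE inE hs => -[xh|yh].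
  by rewrite (xq h hH xh) tpermR; apply/eqP.
have Ch := yp h hH yh; rewrite Ch tpermL => _.
(* If [y] were the far end, the end edges would have the different colors [q] and [p], so by parity
   [y] would be on the side of its neighbour [x]. *)
have := altpath_side side_edge h tc ap es0.
case: (altpath_inner ap hs yh) => [[yx _]|[yl hl]|[h' [h's yh' /eqP[]]]].
- by rewrite yx eqxx in xy.
- have -> : last h es = h by rewrite [RHS]hl.
  have -> : head h es = f0.
    by rewrite (altpath_head_eq h ap fes xf0).
  by rewrite -yl Ch Cf0 pq eq_sym (negbTE xy).
by rewrite Ch; apply: yp yh'; apply: altpath_in ap h's.
Qed.

Definition extra D := [set f : edge E | (C2 f == a) && (D f \in S)].

(** The edges at [x] with unsettled colors and [m] itself all have distinct [C2]-colors outside [S],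
    while [m] now occupies a settled color; so one unsettled color is free at [x]. *)
Lemma extra_missing C m x : proper_coloring C -> keeps C -> m \in extra C ->
  x \in val m -> exists2 p, p \notin S & forall h, x \in val h -> C h <> p.
Proof.
move=> /proper_coloringP ok kC; rewrite inE => /andP[/eqP C2m CmS] xm.
have mQ : C m \in ~: S = false by rewrite inE CmS.
have [||| p] := @missing_color x (~: S) (m |: [set f : edge E | (x \in val f) && (C f \in ~: S)]) C m.
- move=> f; rewrite in_setU1 => /orP[/eqP->|]; first by rewrite inE C2m.
  rewrite inE => /andP[xf]; rewrite !inE => CfS; split=> //.
  by apply: contra CfS => fS; rewrite kC.
- by rewrite setU11.
- move=> f xf CfQ; exists f => //; rewrite in_setD1 in_setU1 inE xf CfQ orbT andbT.
  by apply: contraTneq CfQ => ->; rewrite mQ.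
by rewrite inE; exists p.
Qed.

Lemma fix_extra C m : proper_coloring C -> keeps C -> m \in extra C ->
  exists D, [/\ proper_coloring D, keeps D, conn 2 C D & extra D = extra C :\ m].
Proof.
move=> Cp kC mX; have [x [y mxy]] := edge_ends m; have xy := side_edge mxy.
have xm : x \in val m by rewrite mxy !inE eqxx.
have ym : y \in val m by rewrite mxy !inE eqxx orbT.
have [p pS missp] := extra_missing Cp kC mX xm.
have [q qS missq] := extra_missing Cp kC mX ym.
move: (mX); rewrite inE => /andP[/eqP C2m CmS].
have [D [Dp kD CD Dm [XD missD]]] : exists D, [/\ proper_coloring D, keeps D,
    conn 1 C D, D m = C m & extra D = extra C /\
    forall h, x \in val h \/ y \in val h -> D h <> q].
  have [pq|pq] := eqVneq p q.
    exists C; split=> //; first exact: conn_leq (conn_refl 0 C).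
    by split=> // h [/missp|/missq]; rewrite ?pq.
  have [F [FH Dp CD miss]] := kempe Cp pq mxy missp missq.
  have inS f : (flip C p q F f \in S) = (C f \in S) /\ (C f \in S -> flip C p q F f = C f).
    rewrite flipE; case: ifP => // /(subsetP FH)/class2P[]->.
      by rewrite tpermL (negbTE pS) (negbTE qS).
    by rewrite tpermR (negbTE pS) (negbTE qS).
  exists (flip C p q F); split=> //; first exact: keeps_flip.
    exact: (inS m).2.
  by split=> //; apply/setP=> f; rewrite !in_set (inS f).1.
have mq : C m != q by apply: contraNneq qS => <-.
have mK : m \in color_class2 D (C m) q by apply/class2P; left.
pose D' := flip D (C m) q [set m].
have okD := elimT (proper_coloringP D) Dp.
have D'E h : D' h = if h == m then q else D h.
  by rewrite flipE in_set1; case: eqP => // ->; rewrite Dm tpermL.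
have Dp' : proper_coloring D'.
  apply/proper_coloringP=> v.
  have [vm|vm] := boolP (v \in val m); last first.
    apply: ok_ext (okD v) => h; apply: flip_away => g /set1P->; exact: vm.
  case: (recolor_ok (okD v) vm Dm mq) => // -[g [mg _ vg _ Dg _ _ _]].
  move: Dg; rewrite -/D' D'E eq_sym (negbTE mg) => Dg.
  case: (missD g) => //; move: vm; rewrite mxy !inE.
  by case/orP=> /eqP <-; [left | right].
exists D'; split=> //.
- move=> f fS; rewrite D'E; case: (f =P m) => [fm|_]; last exact: kD.
  by rewrite fm C2m (negbTE aS) in fS.
- apply: (conn_trans CD); apply: conn1 => //.
  apply: (chain_step2 mq (proj1 (reach_refl D _ _)) (recolor2_proper_edge Dp mK)).
  by apply: (@eliminate_proper _ _ _ 0) => //; apply: ret_pos.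
rewrite -XD; apply/setP=> f; rewrite in_setD1 !in_set D'E.
by case: (f =P m) => [_|//]; rewrite (negbTE qS) andbF.
Qed.

Lemma clear_extra C : proper_coloring C -> keeps C ->
  exists2 C', proper_coloring C' /\ inv C' & conn (2 * #|extra C|) C C'.
Proof.
have [n] := ubnP #|extra C|; elim: n C => // n IH C; rewrite ltnS => le Cp kC.
have [X0|/set0Pn[m mX]] := eqVneq (extra C) set0.
  exists C; last exact: conn_refl.
  split=> //; split=> // f fa; apply/negP=> fS.
  by have := in_set0 f; rewrite -X0 inE fa eqxx fS.
have [D [Dp kD CD XD]] := fix_extra Cp kC mX.
have lt : #|extra C| = #|extra D|.+1 by rewrite (cardsD1 m) mX XD.
have [|C' C'P DC'] := IH D _ Dp kD; first by rewrite -lt.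
by exists C' => //; rewrite lt mulnS; apply: conn_trans CD DC'.
Qed.

Lemma settle_color C : proper_coloring C -> keeps C ->
  exists2 C', proper_coloring C' /\ (forall f, C2 f \in a |: S -> C' f = C2 f)
    & conn (6 * #|[set f | C2 f == a]|) C C'.
Proof.
move=> Cp kC; have [C1 [C1p iC1] CC1] := clear_extra Cp kC.
have [C3 [C3p [kC3 _] w0] C1C3] := fix_color C1p iC1.
exists C3.
  split=> // f; rewrite in_setU1 => /orP[/eqP fa|]; last exact: kC3.
  apply/eqP; rewrite fa; apply/negPn/negP=> C3f.
  by have := in_set0 f; rewrite -w0 inE fa eqxx C3f.
apply: conn_leq (conn_trans CC1 C1C3).
rewrite (mulnDl 2 4); apply: leq_add; rewrite leq_mul2l /=; apply: subset_leq_card;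
  by apply/subsetP=> f; rewrite !inE => /andP[].
Qed.

End Run.

(** * Settling all color classes: they partition the edges, so the costs add up to 6|E| *)

Lemma proper_conn (V : finType) (E : {set {set V}}) k (side : V -> bool)
    (C1 C2 : colormap E k) :
  (forall e : edge E, exists x y, val e = [set x; y]) ->
  (forall (e : edge E) x y, val e = [set x; y] -> side x != side y) ->
  proper_coloring C1 -> proper_coloring C2 -> conn (6 * #|E|) C1 C2.
Proof.
move=> ends sides C1p C2p; have ok2 := elimT (proper_coloringP C2) C2p.
suff [C C12 CC] : exists2 C, proper_coloring C /\ (forall f, C2 f \in enum 'I_k -> C f = C2 f)
    & conn (6 * #|[set f | C2 f \in enum 'I_k]|) C1 C.
  have -> : C2 = C by apply/ffunP=> f; rewrite C12.2 // mem_enum.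
  apply: conn_leq CC; rewrite leq_mul2l /= -(card_sig (mem E)); exact: max_card.
elim: (enum 'I_k) (enum_uniq 'I_k) => [_|a cs IH /= /andP[acs ucs]].
  by exists C1; [split | apply: conn_refl].
have [C [Cp kC] C1C] := IH ucs.
have [|| C' [C'p kC'] CC'] := settle_color ends sides ok2 (S := [set c in cs]) (a := a) _ Cp.
- by rewrite inE.
- by move=> f; rewrite inE; apply: kC.
exists C'; first by split=> // f fcs; apply: kC'; rewrite !inE in fcs *.
apply: conn_leq (conn_trans C1C CC'); rewrite -mulnDr leq_mul2l /=.
rewrite -cardsUI (_ : _ :&: _ = set0) ?cards0 ?addn0.
  by apply: subset_leq_card; apply/subsetP=> f; rewrite !inE orbC.
by apply/setP=> f; rewrite !inE; apply/andP=> -[fcs /eqP fa];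
  rewrite fa (negbTE acs) in fcs.
Qed.

Theorem theorem3p1 (V : finType) (E : {set {set V}}) (k : nat)
  (simpleG : simple_graph E) (bipartiteG : bipartite E)
  (maxdeg_le : max_degree E <= k) (C1 C2 : edge_coloring E k) :
  exists s : seq (edge_coloring E k),
    [/\ path (fun C C' => (0 < transition C C')%R) C1 s,
        last C1 s = C2 & size s <= 6 * #|E|].
Proof.
have [X bipX] := bipartiteG.
have ends (e : edge E) : exists x y, val e = [set x; y].
  have /eqP/cards2P[x [y [_ exy]]] := simpleG _ (valP e).
  by exists x, y.
have sides (e : edge E) x y : val e = [set x; y] -> (x \in X) != (y \in X).
  move=> exy; have := bipX _ (valP e); have := simpleG _ (valP e); rewrite exy cards2.
  case: (x =P y) => // /eqP xy _.
  case xX: (x \in X); case yX: (y \in X) => // /eqP/cards1P[z /setP dz].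
    have := dz x; have := dz y; rewrite !inE !eqxx xX yX orbT /= =>
      /esym/eqP yz /esym/eqP xz.
    by rewrite xz yz eqxx in xy.
  by have := dz z; rewrite !inE eqxx => /andP[/orP[]/eqP->]; rewrite ?xX ?yX.
have [s [pth lst sz]] := proper_conn ends sides (valP C1) (valP C2).
suff [t [tp tl ts]] : exists t : seq (edge_coloring E k),
    [/\ path (fun C C' => (0 < transition C C')%R) C1 t, last C1 t = C2
      & size t = size s] by exists t; rewrite ts.
elim: s C1 pth lst {sz} => [|D s IH] C1 /= => [_ lst|/andP[/andP[Dp pos] pth] lst].
  by exists [::]; split=> //; apply: val_inj.
have [t [tp tl ts]] := IH (Sub D Dp) pth lst.
by exists (Sub D Dp :: t); split; rewrite /= ?ts ?tp ?andbT.
Qed.
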